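(* Let $d\ge 2$, $\beta>0$, $J\in\{-1,+1\}$ and $h=0$. Let $\mathbb{P}$ be the law on $\Omega=\{-1,+1\}^{\mathbb{Z}^d}$ of a Markov random field $\mathbb{X}=\{X_x\}_{x\in\mathbb{Z}^d}$ whose single-site conditional probabilities are $$\mathbb{P}\big(X_x=+1\,\big|\,X_{\mathbb{Z}^d\setminus x}=\sigma_{\mathbb{Z}^d\setminus x}\big)=\frac{e^{\beta h}e^{\beta J\sum_{y\sim x}\sigma_y}}{2\cosh\big(\beta h+\beta J\sum_{y\sim x}\sigma_y\big)}$$ (with $h=0$). Set $c=2\beta h+4\beta d$ and $p=e^{-2\beta h}\big(e^{4\beta d}-e^{-4\beta d}\big)$ (so here $c=4\beta d$, $p=e^{4\beta d}-e^{-4\beta d}$), and assume $p<1$ and $$\mathbb{E}_p\big(|\mathcal{C}|e^{c|\mathcal{C}|}\big)<\infty,$$ where $\mathcal{C}$ is the open cluster of the origin in independent Bernoulli site percolation on $\mathbb{Z}^d$ with parameter $p$, and $\mathbb{E}_p$ is expectation under that percolation measure. Then $\mathbb{P}$ satisfies the Poincaré inequality: there is a constant $C_P>0$ such that for all $f\in L^2(\mathbb{P})$, $$\int \big(f-\mathbb{E}(f)\big)^2\,d\mathbb{P}\le C_P\,\mathcal{E}(f,f).$$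
   Context: $x\sim y$ means $x,y$ are nearest neighbours in $\mathbb{Z}^d$. For $\eta\in\Omega$ and $x\in\mathbb{Z}^d$, $\eta^x$ denotes the configuration obtained from $\eta$ by flipping the spin at $x$ (i.e. $\eta^x_x=-\eta_x$, $\eta^x_y=\eta_y$ for $y\ne x$), and $\nabla_x f(\eta)=f(\eta^x)-f(\eta)$. The quadratic form is $\mathcal{E}(f,f)=\sum_{x\in\mathbb{Z}^d}\int(\nabla_x f)^2\,d\mathbb{P}$ (possibly infinite). *)

(* Defs.v *)
From HB Require Import structures.
From mathcomp Require Import all_boot all_order all_algebra.
From mathcomp Require Import all_classical all_reals all_analysis.

Set Implicit Arguments.
Unset Strict Implicit.
Unset Printing Implicit Defensive.

Import Order.TTheory GRing.Theory Num.Theory.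
Local Open Scope classical_set_scope.
Local Open Scope ring_scope.

Definition site (d : nat) := 'rV[int]_d.

Definition unitv (d : nat) (i : 'I_d) : site d := delta_mx 0 i.

Definition adj (d : nat) : rel (site d) :=
  fun x y => [exists i : 'I_d, (y == x + unitv i) || (y == x - unitv i)].

(* Configurations {-1,+1}^{Z^d} (true = +1), also used for {closed,open}^{Z^d}
   in site percolation (true = open). *)
Definition config (d : nat) := site d -> bool.

Definition coord_events (d : nat) : set (set (config d)) :=
  [set A | exists (x : site d) (b : bool), A = [set w | w x = b]].

Definition Omega (d : nat) := g_sigma_algebraType (@coord_events d).

Definition coord_events_off (d : nat) (x : site d) : set (set (config d)) :=
  [set A | exists (y : site d) (b : bool), y != x /\ A = [set w | w y = b]].
Definition sigma_off (d : nat) (x : site d) : set (set (config d)) :=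
  <<s @coord_events_off d x >>.

Definition spin (R : realType) (d : nat) (w : config d) (x : site d) : R :=
  if w x then 1 else -1.

Definition nbr_sum (R : realType) (d : nat) (w : config d) (x : site d) : R :=
  \sum_(i < d) (spin R w (x + unitv i) + spin R w (x - unitv i)).

Definition ising_cond (R : realType) (d : nat) (beta J h : R)
    (w : config d) (x : site d) : R :=
  let a := beta * h + beta * J * nbr_sum R w x in
  expR (beta * h) * expR (beta * J * nbr_sum R w x) / (expR a + expR (- a)).

Definition ising_mrf (R : realType) (d : nat) (beta J h : R)
    (P : probability (Omega d) R) : Prop :=
  forall (x : site d) (B : set (Omega d)), sigma_off x B ->
    P ([set w | w x = true] `&` B) =
    (\int[P]_(w in B) (ising_cond beta J h w x)%:E)%E.

Definition bernoulli_site (R : realType) (d : nat) (p : R)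
    (Q : probability (Omega d) R) : Prop :=
  forall (S : seq (site d)) (b : site d -> bool), uniq S ->
    Q [set w : Omega d | forall y, y \in S -> w y = b y] =
    (\prod_(y <- S) (if b y then p else 1 - p))%:E.

Definition cluster (d : nat) (w : config d) : set (site d) :=
  [set y | exists s : seq (site d),
     [&& path (@adj d) 0 s, last 0 s == y & all w (0 :: s)]].

Definition cluster_size (R : realType) (d : nat) (w : config d) : \bar R :=
  (\esum_(y in cluster w) 1)%E.

Definition size_weight (R : realType) (c : R) (n : \bar R) : \bar R :=
  match n with
  | r%:E => (r * expR (c * r))%:E
  | _ => +oo%E
  end.

Definition flip (d : nat) (x : site d) (w : config d) : config d :=
  fun y => if y == x then ~~ w y else w y.

Definition dirichlet_form (R : realType) (d : nat)
    (P : probability (Omega d) R) (f : Omega d -> R) : \bar R :=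
  (\esum_(x in [set: site d])
     \int[P]_w ((f (flip x w) - f w) ^+ 2)%:E)%E.

(* Main.v *)
Require Import Defs.
From HB Require Import structures.
From mathcomp Require Import all_boot all_order all_algebra.
From mathcomp Require Import all_classical all_reals all_analysis.
From mathcomp Require Import measurable_realfun ring lra.
Import Order.TTheory GRing.Theory Num.Theory.
Local Open Scope classical_set_scope.
Local Open Scope ring_scope.

Set Implicit Arguments.
Unset Strict Implicit.
Unset Printing Implicit Defensive.

(** Write [D_x f] for [f] minus its conditional expectation given the spins off
    [x], and [lam = exp (4 beta)]. The assumption [p < 1] gives
    [exp (4 beta d) < 2], hence [gam = 1 - d (lam - 1) > 0] by Bernoulli's
    inequality: the interaction is weak enough for Dobrushin-type arguments.

    In finite volume the generator is [L = sum_x D_x], and the energy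
    [sum_x |D_x f|^2 = <L f, f>] satisfies [|L f|^2 >= gam * energy f]: the terms
    [<D_x f, D_y f>] vanish up to a nonnegative part when [x] and [y] are not
    neighbours, and otherwise a computation on the four configurations of the
    spins at [x], [y] bounds them below by
    [- (lam - 1) / 4 * (|D_x f|^2 + |D_y f|^2)]. Along the iteration of
    [T = 1 - L / N] the energy therefore decreases geometrically, and
    [|f|^2 <= |T^k f|^2 + 2 / gam * energy f] with a constant independent of the
    volume.

    It remains to see that [T^k f] tends to the mean of [f] as [k] and then the
    volume grow. As [T] is a contraction of [L^2] one may replace [f] by a bounded
    cylinder function, and then the oscillations [sup |g (flip y w) - g w|] contract
    under [T] in a weighted sum whose weights double with each layer around the
    support of [f], so that little oscillation reaches the boundary. *)

(** * A correlation inequality for two spins *)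

(** The dynamics lives on a finite list [s] of sites, while [P] remains the law on the whole
    lattice. So [L] is bounded and the discrete steps [1 - L / N] can replace a semigroup. The price
    is that functions of the spins outside [s] are fixed by [T]: there is no spectral gap with
    respect to [P] to appeal to, the decay of [T^k f] must come from the oscillations with [s]
    chosen according to the accuracy, and it matters that [2 / gam] does not depend on [s]. The same
    [gam] serves both arguments. A site passes an influence [(lam - 1) / 4] to each of its [2 d]
    neighbours; the energy estimate charges each site twice, as a row and as a column, and the
    oscillation estimate pays a factor 2 for the doubling weights. Both give [d (lam - 1)].
    Conditional expectations are never formed as such. The law enters through the ratio [r x w] of
    the weights of [flip x w] and [w], and averaging over one or two spins becomes an explicit
    change of variables by flips. *)

Section TwoSite.
Context (R : realFieldType).
Implicit Types (a b m s t u v lam A B C D X Y : R).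

(** Cauchy-Schwarz in the form [(u + v)^2 <= u^2 / s + v^2 / t]; the defect is the square
    [(t u - s v)^2 / (s t)]. *)
Lemma sqr_sum_weighted m s t a b u v : 0 < s -> 0 < t -> s + t = 1 ->
  0 <= m -> m <= a * s -> m <= b * t -> m * (u + v) ^+ 2 <= a * u ^+ 2 + b * v ^+ 2.
Proof.
move=> s0 t0 st m0 ma mb.
have Ha : m / s <= a by rewrite ler_pdivrMr.
have Hb : m / t <= b by rewrite ler_pdivrMr.
apply: (@le_trans _ _ (m / s * u ^+ 2 + m / t * v ^+ 2)); last first.
  by apply: lerD; apply: ler_wpM2r => //; apply: sqr_ge0.
have tE : t = 1 - s by rewrite -st; ring.
rewrite -subr_ge0.
have -> : m / s * u ^+ 2 + m / t * v ^+ 2 - m * (u + v) ^+ 2 =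
  m / (s * t) * (t * u - s * v) ^+ 2.
  by rewrite tE; field; rewrite -tE !gt_eqF.
by rewrite mulr_ge0 ?sqr_ge0 // divr_ge0 // ltW // mulr_gt0.
Qed.

(** Allows a coefficient [k] to be replaced by a reference value [c] at distance at most [e],
    whatever the sign of [X * Y]. *)
Lemma mul_dev_ge c k e X Y : c - e <= k -> k <= c + e ->
  c * (X * Y) - e * (`|X| * `|Y|) <= k * (X * Y).
Proof.
move=> h1 h2; rewrite -normrM; have [h|h] := ger0P (X * Y).
  rewrite -mulrBl; exact: ler_wpM2r.
rewrite mulrN opprK -mulrDl; apply: ler_wnM2r => //; exact: ltW.
Qed.

(* The coefficients are compared to [c = m (1 + lam) / 2], for which the form is
   [c * (X - X') ^+ 2] by the relation between [X], [X'], [Y], [Y']. *)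
Lemma four_coef_bound lam m A B C D X X' Y Y' nx ny :
  1 <= lam -> 0 <= m -> X - X' = Y - Y' ->
  m <= A -> m <= B -> m <= C -> m <= D ->
  A <= lam * m -> B <= lam * m -> C <= lam * m -> D <= lam * m ->
  m * (`|X| + `|X'|) ^+ 2 <= nx -> m * (`|Y| + `|Y'|) ^+ 2 <= ny ->
  - ((lam - 1) / 4) * (nx + ny) <=
  A * (X * Y) - B * (X * Y') - C * (X' * Y) + D * (X' * Y').
Proof.
move=> l1 m0 E mA mB mC mD Al Bl Cl Dl Hx Hy.
(* Midpoint and half-length of the interval from [m] to [lam * m], which contains the four
   coefficients. *)
set c := m * (1 + lam) / 2; set e := m * (lam - 1) / 2.
have ce : c - e = m by rewrite /c /e; field.
have cE : c + e = lam * m by rewrite /c /e; field.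
have e0 : 0 <= e by rewrite /e divr_ge0 // mulr_ge0 // subr_ge0.
have c0 : 0 <= c by lra.
have HA := @mul_dev_ge c A e X Y ltac:(by rewrite ce) ltac:(by rewrite cE).
have HB := @mul_dev_ge (- c) (- B) e X Y' ltac:(lra) ltac:(lra).
have HC := @mul_dev_ge (- c) (- C) e X' Y ltac:(lra) ltac:(lra).
have HD := @mul_dev_ge c D e X' Y' ltac:(by rewrite ce) ltac:(by rewrite cE).
have HZ : 0 <= c * (X * Y - X * Y' - X' * Y + X' * Y').
  have -> : X * Y - X * Y' - X' * Y + X' * Y' = (X - X') ^+ 2.
    by rewrite expr2 {2}E; ring.
  by rewrite mulr_ge0 // sqr_ge0.
set p := `|X| + `|X'| in Hx; set q := `|Y| + `|Y'| in Hy.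
(* The four error terms add up to [e p q], and [p q <= (p^2 + q^2) / 2]; this is the origin of the
   constant [(lam - 1) / 4]. *)
have Hpq : e * (p * q) <= (lam - 1) / 4 * (nx + ny).
  have h : m * (p ^+ 2 + q ^+ 2) <= nx + ny by lra.
  have h2 : (lam - 1) / 4 * (m * (p ^+ 2 + q ^+ 2)) <= (lam - 1) / 4 * (nx + ny).
    by apply: ler_wpM2l => //; lra.
  apply: le_trans h2.
  rewrite -subr_ge0.
  have -> : (lam - 1) / 4 * (m * (p ^+ 2 + q ^+ 2)) - e * (p * q) =
    e / 2 * (p - q) ^+ 2 by rewrite /e; field.
  by rewrite mulr_ge0 ?sqr_ge0 // divr_ge0.
have Epq : e * (p * q) = e * (`|X| * `|Y|) + e * (`|X| * `|Y'|) +
  e * (`|X'| * `|Y|) + e * (`|X'| * `|Y'|) by rewrite /p /q; ring.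
lra.
Qed.

(** The indices 1, 2, 3, 4 stand for a configuration and its modifications by a flip at [x], at [y],
    and at both; [w1, ..., w4] are unnormalised weights. This is the weighted sum of [D_x f * D_y f]
    over the four, and [two_site_norm] is that of [(D_x f)^2]. Exchanging the indices 2 and 3
    exchanges [x] and [y]. *)
Definition two_site_form (w1 w2 w3 w4 f1 f2 f3 f4 : R) : R :=
  w1 * (w2 / (w1 + w2) * (f1 - f2)) * (w3 / (w1 + w3) * (f1 - f3)) +
  w2 * (w1 / (w1 + w2) * (f2 - f1)) * (w4 / (w2 + w4) * (f2 - f4)) +
  w3 * (w4 / (w3 + w4) * (f3 - f4)) * (w1 / (w1 + w3) * (f3 - f1)) +
  w4 * (w3 / (w3 + w4) * (f4 - f3)) * (w2 / (w2 + w4) * (f4 - f2)).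

Definition two_site_norm (w1 w2 w3 w4 f1 f2 f3 f4 : R) : R :=
  w1 * (w2 / (w1 + w2) * (f1 - f2)) ^+ 2 + w2 * (w1 / (w1 + w2) * (f2 - f1)) ^+ 2 +
  w3 * (w4 / (w3 + w4) * (f3 - f4)) ^+ 2 + w4 * (w3 / (w3 + w4) * (f4 - f3)) ^+ 2.

Lemma div_le_div a b c e : 0 < b -> 0 < e -> a * e <= c * b -> a / b <= c / e.
Proof. by move=> b0 e0 h; rewrite ler_pdivrMr // mulrAC ler_pdivlMr. Qed.

(** The order assumed between [w2 w3] and [w1 w4] puts the coefficients [A] and [D] below [B] and
    [C], and the factor [lam] bounds [B] and [C] by [lam] times either of them. So all four lie
    between [m] and [lam * m] for [m] the smaller of [A] and [D]. *)
Lemma two_site_bound_ordered lam w1 w2 w3 w4 f1 f2 f3 f4 :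
  0 < w1 -> 0 < w2 -> 0 < w3 -> 0 < w4 -> 1 <= lam ->
  w2 * w3 <= w1 * w4 -> w1 * w4 <= lam * (w2 * w3) ->
  - ((lam - 1) / 4) * (two_site_norm w1 w2 w3 w4 f1 f2 f3 f4 +
                       two_site_norm w1 w3 w2 w4 f1 f3 f2 f4) <=
  two_site_form w1 w2 w3 w4 f1 f2 f3 f4.
Proof.
move=> p1 p2 p3 p4 l1 h1 h2.
set X := f1 - f2; set X' := f3 - f4; set Y := f1 - f3; set Y' := f2 - f4.
have p12 : 0 < w1 + w2 by apply: addr_gt0.
have p13 : 0 < w1 + w3 by apply: addr_gt0.
have p24 : 0 < w2 + w4 by apply: addr_gt0.
have p34 : 0 < w3 + w4 by apply: addr_gt0.
set A := w1 * w2 * w3 / ((w1 + w2) * (w1 + w3)).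
set B := w1 * w2 * w4 / ((w1 + w2) * (w2 + w4)).
set C := w1 * w3 * w4 / ((w3 + w4) * (w1 + w3)).
set D := w2 * w3 * w4 / ((w3 + w4) * (w2 + w4)).
have nz : [/\ w1 + w2 != 0, w1 + w3 != 0, w2 + w4 != 0 & w3 + w4 != 0].
  by split; rewrite gt_eqF.
have {nz} [z12 z13 z24 z34] := nz.
have -> : two_site_form w1 w2 w3 w4 f1 f2 f3 f4 =
  A * (X * Y) - B * (X * Y') - C * (X' * Y) + D * (X' * Y').
  rewrite /two_site_form /A /B /C /D /X /X' /Y /Y'; field.
  by rewrite z12 z13 z24 z34.
have -> : two_site_norm w1 w2 w3 w4 f1 f2 f3 f4 =
  w1 * w2 / (w1 + w2) * `|X| ^+ 2 + w3 * w4 / (w3 + w4) * `|X'| ^+ 2.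
  rewrite !real_normK ?num_real // /two_site_norm /X /X'; field.
  by rewrite z12 z34.
have -> : two_site_norm w1 w3 w2 w4 f1 f3 f2 f4 =
  w1 * w3 / (w1 + w3) * `|Y| ^+ 2 + w2 * w4 / (w2 + w4) * `|Y'| ^+ 2.
  rewrite !real_normK ?num_real // /two_site_norm /Y /Y'; field.
  by rewrite z13 z24.
have wge0 a b : 0 < a -> 0 < b -> 0 <= a * b by move=> *; rewrite ltW ?mulr_gt0.
have q12 : 0 <= w1 * w2 * (w1 + w2) by apply/wge0/p12/mulr_gt0.
have q13 : 0 <= w1 * w3 * (w1 + w3) by apply/wge0/p13/mulr_gt0.
have q24 : 0 <= w2 * w4 * (w2 + w4) by apply/wge0/p24/mulr_gt0.
have q34 : 0 <= w3 * w4 * (w3 + w4) by apply/wge0/p34/mulr_gt0.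
have {wge0} [r12 r13 r24 r34] :
  [/\ 0 <= w1 * w2, 0 <= w1 * w3, 0 <= w2 * w4 & 0 <= w3 * w4].
  by split; apply: wge0.
have k1 : 0 <= w1 * w4 - w2 * w3 by rewrite subr_ge0.
have k2 : 0 <= lam * (w2 * w3) - w1 * w4 by rewrite subr_ge0.
have k3 : 0 <= lam - 1 by rewrite subr_ge0.
have AB : A <= B.
  apply: div_le_div; rewrite ?mulr_gt0 // -subr_ge0.
  have -> : w1 * w2 * w4 * ((w1 + w2) * (w1 + w3)) -
    w1 * w2 * w3 * ((w1 + w2) * (w2 + w4)) =
    w1 * w2 * (w1 + w2) * (w1 * w4 - w2 * w3) by ring.
  exact: mulr_ge0.
have AC : A <= C.
  apply: div_le_div; rewrite ?mulr_gt0 // -subr_ge0.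
  have -> : w1 * w3 * w4 * ((w1 + w2) * (w1 + w3)) -
    w1 * w2 * w3 * ((w3 + w4) * (w1 + w3)) =
    w1 * w3 * (w1 + w3) * (w1 * w4 - w2 * w3) by ring.
  exact: mulr_ge0.
have DB : D <= B.
  apply: div_le_div; rewrite ?mulr_gt0 // -subr_ge0.
  have -> : w1 * w2 * w4 * ((w3 + w4) * (w2 + w4)) -
    w2 * w3 * w4 * ((w1 + w2) * (w2 + w4)) =
    w2 * w4 * (w2 + w4) * (w1 * w4 - w2 * w3) by ring.
  exact: mulr_ge0.
have DC : D <= C.
  apply: div_le_div; rewrite ?mulr_gt0 // -subr_ge0.
  have -> : w1 * w3 * w4 * ((w3 + w4) * (w2 + w4)) -
    w2 * w3 * w4 * ((w3 + w4) * (w1 + w3)) =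
    w3 * w4 * (w3 + w4) * (w1 * w4 - w2 * w3) by ring.
  exact: mulr_ge0.
have BA : B <= lam * A.
  rewrite /A mulrA; apply: div_le_div; rewrite ?mulr_gt0 // -subr_ge0.
  have -> : lam * (w1 * w2 * w3) * ((w1 + w2) * (w2 + w4)) -
    w1 * w2 * w4 * ((w1 + w2) * (w1 + w3)) = w1 * w2 * (w1 + w2) *
    ((lam * (w2 * w3) - w1 * w4) + (lam - 1) * (w3 * w4)) by ring.
  by apply: mulr_ge0 => //; apply: addr_ge0 => //; apply: mulr_ge0.
have CA : C <= lam * A.
  rewrite /A mulrA; apply: div_le_div; rewrite ?mulr_gt0 // -subr_ge0.
  have -> : lam * (w1 * w2 * w3) * ((w3 + w4) * (w1 + w3)) -
    w1 * w3 * w4 * ((w1 + w2) * (w1 + w3)) = w1 * w3 * (w1 + w3) *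
    ((lam * (w2 * w3) - w1 * w4) + (lam - 1) * (w2 * w4)) by ring.
  by apply: mulr_ge0 => //; apply: addr_ge0 => //; apply: mulr_ge0.
have BD : B <= lam * D.
  rewrite /D mulrA; apply: div_le_div; rewrite ?mulr_gt0 // -subr_ge0.
  have -> : lam * (w2 * w3 * w4) * ((w1 + w2) * (w2 + w4)) -
    w1 * w2 * w4 * ((w3 + w4) * (w2 + w4)) = w2 * w4 * (w2 + w4) *
    ((lam * (w2 * w3) - w1 * w4) + (lam - 1) * (w1 * w3)) by ring.
  by apply: mulr_ge0 => //; apply: addr_ge0 => //; apply: mulr_ge0.
have CD : C <= lam * D.
  rewrite /D mulrA; apply: div_le_div; rewrite ?mulr_gt0 // -subr_ge0.
  have -> : lam * (w2 * w3 * w4) * ((w3 + w4) * (w1 + w3)) -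
    w1 * w3 * w4 * ((w3 + w4) * (w2 + w4)) = w3 * w4 * (w3 + w4) *
    ((lam * (w2 * w3) - w1 * w4) + (lam - 1) * (w1 * w2)) by ring.
  by apply: mulr_ge0 => //; apply: addr_ge0 => //; apply: mulr_ge0.
have A0 : 0 <= A by rewrite divr_ge0 // ?mulr_ge0 // ltW.
have D0 : 0 <= D by rewrite divr_ge0 // ?mulr_ge0 // ltW.
have [m [[m0 mA mD Bm Cm] [Am Dm]]] : exists m, [/\ 0 <= m, m <= A, m <= D,
  B <= lam * m & C <= lam * m] /\ (A <= lam * m /\ D <= lam * m).
  have [AD|/ltW DA] := lerP A D; [exists A | exists D].
    by do !split => //; [exact: le_trans AB BA | exact: le_trans DB BA].
  by do !split => //; [exact: le_trans AB BD | exact: le_trans DB BD].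
have mB := le_trans mA AB; have mC := le_trans mA AC.
apply: (@four_coef_bound lam m) => //.
- by rewrite /X /X' /Y /Y'; ring.
(* The two weights of the norm, multiplied by these fractions, are exactly [A] and [C]; in the next
   case they are [A] and [B]. *)
- apply: (@sqr_sum_weighted _ (w3 / (w1 + w3)) (w1 / (w1 + w3))) => //.
  + exact: divr_gt0.
  + exact: divr_gt0.
  + by field.
  + by apply: le_trans mA _; rewrite /A le_eqVlt; apply/orP; left; apply/eqP; field;
      rewrite ?z12 ?z13 ?z24 ?z34.
  + by apply: le_trans mC _; rewrite /C le_eqVlt; apply/orP; left; apply/eqP; field;
      rewrite ?z12 ?z13 ?z24 ?z34.
- apply: (@sqr_sum_weighted _ (w2 / (w1 + w2)) (w1 / (w1 + w2))) => //.
  + exact: divr_gt0.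
  + exact: divr_gt0.
  + by field.
  + by apply: le_trans mA _; rewrite /A le_eqVlt; apply/orP; left; apply/eqP; field;
      rewrite ?z12 ?z13 ?z24 ?z34.
  + by apply: le_trans mB _; rewrite /B le_eqVlt; apply/orP; left; apply/eqP; field;
      rewrite ?z12 ?z13 ?z24 ?z34.
Qed.

(** Starting from the configuration flipped at [x] exchanges 1 with 2 and 3 with 4. Form and norms
    are unchanged, but [w1 w4] and [w2 w3] are exchanged, so one order suffices. *)
Lemma two_site_bound lam w1 w2 w3 w4 f1 f2 f3 f4 :
  0 < w1 -> 0 < w2 -> 0 < w3 -> 0 < w4 -> 1 <= lam ->
  w2 * w3 <= lam * (w1 * w4) -> w1 * w4 <= lam * (w2 * w3) ->
  - ((lam - 1) / 4) * (two_site_norm w1 w2 w3 w4 f1 f2 f3 f4 +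
                       two_site_norm w1 w3 w2 w4 f1 f3 f2 f4) <=
  two_site_form w1 w2 w3 w4 f1 f2 f3 f4.
Proof.
move=> p1 p2 p3 p4 l1 h1 h2.
have [h|/ltW h] := lerP (w2 * w3) (w1 * w4); first exact: two_site_bound_ordered.
have := @two_site_bound_ordered lam w2 w1 w4 w3 f2 f1 f4 f3 p2 p1 p4 p3 l1 h h1.
rewrite /two_site_norm /two_site_form.
rewrite (addrC w2 w1) (addrC w4 w3); lra.
Qed.
End TwoSite.

(** * Integration on the configuration space *)

Section Transfer.
Context {d1 d2 : measure_display} {T1 : measurableType d1} {T2 : measurableType d2}
  {R : realType}.
Import HBNNSimple.

(** The assumption on events says that [nu] restricted to [D] is the image under [phi] of the
    measure with density [g]. It passes to simple functions by linearity and to [F] by monotone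
    convergence. *)
Lemma ge0_integral_transfer (nu : {measure set T2 -> \bar R}) (D : set T2)
    (mu : {measure set T1 -> \bar R}) (phi : T1 -> T2) (g : T1 -> R) :
  measurable D -> measurable_fun setT phi -> measurable_fun setT g ->
  (forall t, 0 <= g t) ->
  (forall A, measurable A ->
    nu (A `&` D) = (\int[mu]_(t in phi @^-1` A) (g t)%:E)%E) ->
  forall F : T2 -> \bar R, measurable_fun setT F -> (forall t, 0 <= F t)%E ->
  (\int[nu]_(t in D) F t = \int[mu]_t (F (phi t) * (g t)%:E))%E.
Proof.
move=> mD mphi mg g0 nuE F mF F0.
pose h := nnsfun_approx (@measurableT _ T2) mF.
have FE x : F x = lim ((EFin \o h n) x @[n --> \oo]).
  by apply/esym/cvg_lim => //; exact: cvg_nnsfun_approx.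
have -> : (\int[nu]_(x in D) F x = lim (\int[nu]_(x in D) (EFin \o h n) x @[n --> \oo]))%E.
  under eq_integral => x _ do rewrite FE.
  apply: monotone_convergence => //.
  - by move=> n; apply/measurable_EFinP; apply: measurable_funTS.
  - by move=> n x _ /=; rewrite lee_fin.
  - by move=> x _ a b ab; rewrite lee_fin; exact/lefP/nd_nnsfun_approx.
have mhphi n : measurable_fun setT (h n \o phi) by exact: measurableT_comp.
have -> : (\int[mu]_t (F (phi t) * (g t)%:E) =
    lim (\int[mu]_t (((EFin \o h n) (phi t)) * (g t)%:E) @[n --> \oo]))%E.
  have FgE t : (F (phi t) * (g t)%:E)%E =
      lim (((EFin \o h n) (phi t) * (g t)%:E)%E @[n --> \oo]).
    by apply/esym/cvg_lim => //; apply: cvgeZr => //; exact: cvg_nnsfun_approx.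
  under eq_integral => t _ do rewrite FgE.
  apply: monotone_convergence => //.
  - move=> n; apply/measurable_EFinP.
    apply: (@measurable_funM _ _ _ _ (h n \o phi) g) => //.
  - by move=> n t _ /=; rewrite mule_ge0 ?lee_fin.
  - move=> t _ a b ab /=; rewrite lee_wpmul2r ?lee_fin //.
    exact/lefP/nd_nnsfun_approx.
suff E n : (\int[nu]_(x in D) (EFin \o h n) x =
    \int[mu]_t (((EFin \o h n) (phi t)) * (g t)%:E))%E.
  by under eq_fun do rewrite E.
transitivity (\int[nu]_(x in D)
   (\sum_(y \in range (h n)) (y * \1_(h n @^-1` [set y]) x)%:E))%E.
  by apply: eq_integral => t tE; rewrite /= fimfunE -fsumEFin.
rewrite ge0_integral_fsum//; last 2 first.
- by move=> r; apply/measurable_EFinP; apply: measurable_funM.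
- by move=> m y _; exact: nnfun_muleindic_ge0.
transitivity (\int[mu]_t (\sum_(y \in range (h n))
    (y * \1_(h n @^-1` [set y]) (phi t))%:E * (g t)%:E))%E; last first.
  apply: eq_integral => t _ /=.
  rewrite -ge0_mule_fsuml => [|y]; last exact: nnfun_muleindic_ge0.
  by rewrite fsumEFin // -(fimfunE _ (phi t)).
have mind r : measurable_fun setT (fun t => \1_(h n @^-1` [set r]) (phi t) : R).
  by apply: (@measurableT_comp _ _ _ _ _ _ (\1_(h n @^-1` [set r]) : T2 -> R)).
rewrite ge0_integral_fsum//; last 2 first.
- move=> r; apply/measurable_EFinP; apply: measurable_funM => //.
  exact: measurable_funM.
- move=> m y _; apply: mule_ge0; last by rewrite lee_fin.
  exact: nnfun_muleindic_ge0.
apply: eq_fsbigr => r rhn.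
have r0 : 0 <= r by move: rhn; rewrite inE => -[t _ <-].
rewrite integralZl_indic_nnsfun // integral_indic // nuE //.
under [RHS]eq_integral do rewrite EFinM -muleA.
rewrite ge0_integralZl//; last 2 first.
- by apply/measurable_EFinP; exact: measurable_funM.
- by move=> t _; rewrite mule_ge0 ?lee_fin.
congr (_ * _)%E; rewrite integral_mkcond; apply: eq_integral => t _.
rewrite patchE indicE /=.
have -> : (phi t \in h n @^-1` [set r]) = (t \in phi @^-1` (h n @^-1` [set r])).
  by apply/idP/idP; rewrite !inE.
by case: ifP => _; rewrite ?mul1e ?mul0e.
Qed.
End Transfer.

Lemma measurable_inv_gt0 {d : measure_display} {T : measurableType d} {R : realType}
    (F : T -> R) : measurable_fun [set: T] F -> (forall w, 0 < F w) ->
  measurable_fun [set: T] (fun w => (F w)^-1).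
Proof.
move=> mF F0; rewrite (_ : (fun _ => _) = (fun w => expR (- ln (F w)))).
  apply: measurableT_comp; first exact: measurable_expR.
  by apply: measurable_funN; apply: measurableT_comp => //; exact: measurable_ln.
by apply/funext => w; rewrite expRN lnK // posrE.
Qed.

Section Config.
Context (d : nat).
Implicit Types (x y : site d) (w : Omega d).

Definition upd x (b : bool) w : Omega d := fun y => if y == x then b else w y.

Lemma measurable_coord x (b : bool) : measurable [set w : Omega d | w x = b].
Proof. by apply: sub_sigma_algebra; exists x, b. Qed.

Lemma measurable_to_Omega {d'} (T : measurableType d') (phi : T -> Omega d) :
  (forall x b, measurable [set t | phi t x = b]) -> measurable_fun setT phi.
Proof.
move=> H; apply: (@measurability _ _ T (Omega d) setT phi (@coord_events d)) => //.
by move=> _ [_ [x [b ->]] <-]; rewrite setTI; exact: H.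
Qed.

Lemma measurable_upd x b : measurable_fun setT (upd x b).
Proof.
apply: measurable_to_Omega => y c; rewrite /upd.
have [_|_] := eqVneq y x; last exact: measurable_coord.
case: (pselect (b = c)) => [->|bc]; last rewrite (_ : mkset _ = set0) //.
  by rewrite (_ : mkset _ = setT) //; apply/seteqP; split.
by apply/seteqP; split.
Qed.

Lemma measurable_flip x : measurable_fun setT (flip x : Omega d -> Omega d).
Proof.
apply: measurable_to_Omega => y c; rewrite /flip.
have [_|_] := eqVneq y x; last exact: measurable_coord.
rewrite (_ : mkset _ = [set w : Omega d | w y = ~~ c]); first exact: measurable_coord.
by apply/seteqP; split => w /=; [move=> <-; rewrite negbK | move=> ->; rewrite negbK].
Qed.

(** An event tested after the spin at [x] has been overwritten no longer looks at that spin; this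
    brings arbitrary events within reach of the specification. *)
Lemma sigma_off_upd x b (A : set (Omega d)) : measurable A -> sigma_off x (upd x b @^-1` A).
Proof.
move=> mA.
suff : <<s @coord_events d >> `<=` [set A | sigma_off x (upd x b @^-1` A)] by apply.
apply: smallest_sub.
  split => /=.
  - by rewrite preimage_set0; exact: sigma_algebra0.
  - move=> B HB; rewrite setTD preimage_setC -setTD; exact: sigma_algebraCD.
  - by move=> F HF; rewrite preimage_bigcup; exact: sigma_algebra_bigcup.
move=> _ [y [c ->]] /=; rewrite /upd.
have [E|yx] := eqVneq y x.
  have [->|bc] := eqVneq b c.
    rewrite (_ : _ @^-1` _ = setT); last by apply/seteqP; split => w //=; rewrite E eqxx.
    by rewrite -setC0 -setTD; apply: sigma_algebraCD; exact: sigma_algebra0.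
  rewrite (_ : _ @^-1` _ = set0); first exact: sigma_algebra0.
  by apply/seteqP; split => w //=; rewrite E eqxx => /eqP; rewrite (negbTE bc).
rewrite (_ : _ @^-1` _ = [set w | w y = c]); last first.
  by apply/seteqP; split => w /=; rewrite (negbTE yx).
by apply: sub_sigma_algebra; exists y, c.
Qed.

Lemma sigma_off_measurable x (A : set (Omega d)) : sigma_off x A -> measurable A.
Proof.
apply: smallest_sub; first exact: smallest_sigma_algebra.
by move=> _ [y [c [_ ->]]]; exact: measurable_coord.
Qed.

Lemma upd_id x w : upd x (w x) w = w.
Proof. by apply/funext => y; rewrite /upd; case: eqVneq => [->|]. Qed.

Lemma flipK x : involutive (@flip d x).
Proof. by move=> w; apply/funext => y; rewrite /flip; case: eqP => // _; rewrite negbK. Qed.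

Lemma flipC x y w : flip x (flip y w) = flip y (flip x w).
Proof. by apply/funext => z; rewrite /flip; do 2 case: eqP => //. Qed.

End Config.

(** * The Ising specification *)

Section Lattice.
Context (d : nat).
Implicit Types (x y : site d).

Definition nbrs x : seq (site d) :=
  [seq x + unitv i | i <- enum 'I_d] ++ [seq x - unitv i | i <- enum 'I_d].

Lemma mem_nbrs x y : (y \in nbrs x) = adj x y.
Proof.
rewrite mem_cat; apply/orP/existsP.
- by case=> /mapP[i _ ->]; exists i; rewrite eqxx ?orbT.
- by case=> i /orP[]/eqP ->; [left|right]; apply: map_f; rewrite mem_enum.
Qed.

Lemma nbrs_sym x y : (y \in nbrs x) = (x \in nbrs y).
Proof.
rewrite !mem_nbrs; apply/existsP/existsP => -[i /orP[]/eqP ->]; exists i.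
- by rewrite addrK eqxx orbT.
- by rewrite subrK eqxx.
- by rewrite addrK eqxx orbT.
- by rewrite subrK eqxx.
Qed.

Lemma unitvE (i j : 'I_d) : unitv i 0 j = (j == i)%:R.
Proof. by rewrite mxE eqxx. Qed.

Lemma unitv_neqN (i j : 'I_d) : unitv i != - unitv j.
Proof.
apply/eqP => /matrixP /(_ 0 i); rewrite !mxE !eqxx /=.
by case: (i == j).
Qed.

Lemma unitv_inj : injective (@unitv d).
Proof.
move=> i j /matrixP /(_ 0 i); rewrite !unitvE eqxx.
by case: eqP.
Qed.

Lemma uniq_nbrs x : uniq (nbrs x).
Proof.
have i1 : injective (fun i => x + @unitv d i) by move=> i j /addrI /unitv_inj.
have i2 : injective (fun i => x - @unitv d i).
  by move=> i j /addrI /oppr_inj /unitv_inj.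
rewrite cat_uniq (map_inj_uniq i1) (map_inj_uniq i2) enum_uniq /= andbT.
apply/hasPn => _ /mapP[i _ ->]; apply/mapP => -[j _ /addrI].
by move=> /esym/eqP; rewrite (negbTE (unitv_neqN _ _)).
Qed.

Lemma nbrs_irrefl x : x \notin nbrs x.
Proof.
rewrite mem_nbrs; apply/existsP => -[i]; apply/negP; rewrite negb_or.
have u0 : unitv i != 0.
  by apply/eqP => /matrixP /(_ 0 i); rewrite unitvE eqxx mxE.
rewrite -{1}(addr0 x) (inj_eq (addrI _)) eq_sym u0 /=.
by rewrite -{1}(addr0 x) (inj_eq (addrI _)) eq_sym oppr_eq0 u0.
Qed.

Lemma size_nbrs x : size (nbrs x) = (2 * d)%N.
Proof.
rewrite /nbrs size_cat (size_map (fun i => x + unitv i)).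
by rewrite (size_map (fun i => x - unitv i)) size_enum_ord mul2n addnn.
Qed.

Lemma nbr_sumE (R : realType) (w : config d) x :
  nbr_sum R w x = \sum_(y <- nbrs x) spin R w y.
Proof.
by rewrite /nbr_sum big_split /= big_cat !big_map -!big_enum.
Qed.

Lemma spin_flip (R : realType) (w : config d) x y :
  spin R (flip x w) y = if y == x then - spin R w y else spin R w y.
Proof.
by rewrite /spin /flip; case: eqP => // _; case: (w y); rewrite ?opprK.
Qed.

Lemma nbr_sum_flip (R : realType) (w : config d) x y :
  nbr_sum R (flip x w) y = nbr_sum R w y - 2 * (x \in nbrs y)%:R * spin R w x.
Proof.
rewrite !nbr_sumE; under eq_bigr do rewrite spin_flip.
have [xy|xy] := boolP (x \in nbrs y); last first.
  rewrite mulr0 mul0r subr0; apply: eq_big_seq => z zy.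
  by case: eqP => // E; rewrite -E zy in xy.
rewrite !(bigD1_seq _ xy (uniq_nbrs y)) /= eqxx.
rewrite (eq_bigr (spin R w)); last by move=> z /negbTE ->.
by rewrite mulr1; ring.
Qed.

Lemma nbr_sum_upd (R : realType) (w : config d) x b :
  nbr_sum R (upd x b w) x = nbr_sum R w x.
Proof.
rewrite !nbr_sumE; apply: eq_big_seq => z zx; rewrite /spin /upd.
by case: eqP => // E; rewrite E (negbTE (nbrs_irrefl x)) in zx.
Qed.

Lemma measurable_spin (R : realType) x :
  measurable_fun setT (fun w : Omega d => spin R w x).
Proof.
rewrite (_ : (fun _ => _) =
    (fun w => \1_[set w : Omega d | w x = true] w - \1_[set w : Omega d | w x = false] w)).
  by apply: measurable_funB; apply: measurable_indic; exact: measurable_coord.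
apply/funext => w; rewrite !indicE /spin.
have -> : (w \in [set w : Omega d | w x = true]) = w x.
  by apply/idP/idP; rewrite inE /= => ->.
have -> : (w \in [set w : Omega d | w x = false]) = ~~ w x.
  by apply/idP/idP; rewrite inE /=; [move=> -> | move/negbTE].
by case: (w x); rewrite ?subr0 ?sub0r.
Qed.

Lemma measurable_nbr_sum (R : realType) x :
  measurable_fun setT (fun w : Omega d => nbr_sum R w x).
Proof.
rewrite (_ : (fun _ => _) = (fun w : Omega d => \sum_(y <- nbrs x) spin R w y)).
  by apply: measurable_sum => y; exact: measurable_spin.
by apply/funext => w; exact: nbr_sumE.
Qed.
End Lattice.

Section FlipRatio.
Context (d : nat) (R : realType) (beta J : R).
Implicit Types (x y : site d) (w : Omega d).

(* The ratio of the weights of [flip x w] and [w]. *)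
Definition flip_ratio x w : R :=
  expR (- (2 * beta * J * (spin R w x * nbr_sum R w x))).

Lemma flip_ratio_gt0 x w : 0 < flip_ratio x w.
Proof. exact: expR_gt0. Qed.

Lemma measurable_flip_ratio x : measurable_fun setT (flip_ratio x).
Proof.
apply: measurableT_comp; first exact: measurable_expR.
apply: measurable_funN; apply: measurable_funM => //.
by apply: measurable_funM; [exact: measurable_spin | exact: measurable_nbr_sum].
Qed.

Lemma flip_ratio_flip x w : flip_ratio x (flip x w) * flip_ratio x w = 1.
Proof.
rewrite /flip_ratio -expRD spin_flip eqxx nbr_sum_flip (negbTE (nbrs_irrefl x)).
by rewrite mulr0 mul0r subr0 -[RHS]expR0; congr expR; ring.
Qed.

(** A flip at [x] affects the ratio at [y] only through the bond between them, by a factor symmetric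
    in [x] and [y] and at most [exp (4 beta)]. The three properties of the ratio that follow are
    read off from this. *)
Lemma flip_ratioE x y w : x != y -> flip_ratio y (flip x w) =
  flip_ratio y w * expR (4 * beta * (J * (x \in nbrs y)%:R * (spin R w x * spin R w y))).
Proof.
move=> xy; rewrite /flip_ratio -expRD spin_flip eq_sym (negbTE xy) nbr_sum_flip.
by congr expR; ring.
Qed.

Lemma flip_ratio_comm x y w : x != y ->
  flip_ratio x w * flip_ratio y (flip x w) = flip_ratio y w * flip_ratio x (flip y w).
Proof.
move=> xy; have yx : y != x by rewrite eq_sym.
by rewrite !flip_ratioE // nbrs_sym (mulrC (spin R w x)) mulrCA.
Qed.

Lemma flip_ratio_nonadj x y w : x != y -> x \notin nbrs y ->
  flip_ratio y (flip x w) = flip_ratio y w.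
Proof.
by move=> xy nxy; rewrite flip_ratioE // (negbTE nxy) mulr0 mul0r mulr0 expR0 mulr1.
Qed.

Lemma flip_ratio_le x y w : 0 < beta -> (J = 1 \/ J = -1) -> x != y ->
  flip_ratio y (flip x w) <= expR (4 * beta) * flip_ratio y w.
Proof.
move=> b0 HJ xy; rewrite flip_ratioE // mulrC; apply: ler_wpM2r; first exact: expR_ge0.
rewrite ler_expR -[leRHS]mulr1; apply: ler_wpM2l; first by rewrite mulr_ge0 // ltW.
case: (x \in nbrs y); rewrite ?mulr0 ?mul0r ?mulr1 //.
by rewrite /spin; case: HJ => ->; case: (w x); case: (w y); lra.
Qed.

Variable (P : probability (Omega d) R).
Hypothesis mrf : ising_mrf beta J 0 P.

Let p x w : R := (1 + expR (- (2 * beta * J * nbr_sum R w x)))^-1.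

Let pE x w : ising_cond beta J 0 w x = p x w.
Proof.
rewrite /ising_cond /p mulr0 expR0 mul1r add0r.
set a := beta * J * _.
have -> : 2 * beta * J * nbr_sum R w x = a + a by rewrite /a; ring.
rewrite opprD expRD !expRN.
have := expR_gt0 a; move: (expR a) => e e0; field.
by rewrite !gt_eqF // addr_gt0 // mulr_gt0.
Qed.

Let p_gt0 x w : 0 < p x w.
Proof. by rewrite invr_gt0 addr_gt0 // expR_gt0. Qed.

Let p_le1 x w : p x w <= 1.
Proof. by rewrite invf_le1 ?addr_gt0 ?expR_gt0 // lerDl expR_ge0. Qed.

Let mp x : measurable_fun setT (p x).
Proof.
apply: measurable_inv_gt0 => [|w]; last by rewrite addr_gt0 // expR_gt0.
apply: measurable_funD => //; apply: measurableT_comp; first exact: measurable_expR.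
by apply: measurable_funN; apply: measurable_funM => //; exact: measurable_nbr_sum.
Qed.

Local Open Scope ereal_scope.

(** Resampling the spin at [x]: on each of the two halves [w x = true] and [w x = false], the
    configuration equals its own update, so the restriction of [P] to that half is transported by
    [upd]. *)
Lemma ising_integral x (F : Omega d -> \bar R) :
  measurable_fun [set: Omega d] F -> (forall w, 0 <= F w) ->
  \int[P]_w F w = \int[P]_w (F (upd x true w) * (p x w)%:E) +
                  \int[P]_w (F (upd x false w) * (1 - p x w)%:E).
Proof.
move=> mF F0.
set D := [set w : Omega d | w x = true].
have mD : measurable D by exact: measurable_coord.
have HP (B : set (Omega d)) : sigma_off x B -> P (D `&` B) = \int[P]_(w in B) (p x w)%:E.
  by move=> HB; rewrite mrf //; apply: eq_integral => w _; rewrite pE.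
have splitP (A : set (Omega d)) b : A `&` [set w : Omega d | w x = b] =
    [set w : Omega d | w x = b] `&` (upd x b @^-1` A).
  by apply/seteqP; split=> w /= []; [move=> Aw <-|move=> <-]; rewrite upd_id.
have DC : ~` D = [set w : Omega d | w x = false].
  by apply/seteqP; split=> w /=; rewrite /D /=; case: (w x).
rewrite -[in LHS](setUv D) ge0_integral_setU //; last 3 first.
- exact: measurableC.
- by rewrite setUv.
- by apply/disj_setPCl => w; apply.
congr (_ + _).
  apply: ge0_integral_transfer => //.
  - exact: measurable_upd.
  - by move=> t; exact: ltW.
  move=> A mA.
  suff : P (A `&` D) = \int[P]_(t in upd x true @^-1` A) (p x t)%:E by [].
  rewrite [X in P X](splitP A true).
  apply: HP; exact: sigma_off_upd.
apply: (@ge0_integral_transfer _ _ _ _ _ _ _ _ _ (fun w => 1 - p x w)%R) => //.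
- exact: measurableC.
- exact: measurable_upd.
- by apply: measurable_funB.
- by move=> t; rewrite subr_ge0.
move=> A mA.
suff : P (A `&` ~` D) = \int[P]_(t in upd x false @^-1` A) (1 - p x t)%:E by [].
rewrite {1}DC (splitP A false) -DC.
set B := upd x false @^-1` A.
have sB : sigma_off x B by exact: sigma_off_upd.
have mB : measurable B by exact: sigma_off_measurable sB.
(* The specification speaks of the plus spin only. The minus case is the complement inside [B],
   obtained by cancelling the finite quantity [P (D]&[B)]. *)
have H1 : P B = P (D `&` B) + P (~` D `&` B).
  rewrite -measureU //; last 3 first.
  - exact: measurableI.
  - by apply: measurableI => //; exact: measurableC.
  - by rewrite setIACA setICr set0I.
  by rewrite -setIUl setUv setTI.
have H2 : P B = P (D `&` B) + \int[P]_(w in B) (1 - p x w)%:E.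
  rewrite HP // -ge0_integralD //; last 4 first.
  - by move=> w _; rewrite lee_fin ltW.
  - by apply/measurable_EFinP/measurable_funTS.
  - by move=> w _; rewrite lee_fin subr_ge0.
  - by apply/measurable_EFinP/measurable_funTS/measurable_funB.
  rewrite -[LHS]mul1e -integral_cst //; apply: eq_integral => w _.
  by rewrite -EFinD addrC subrK.
have fin : P (D `&` B) \is a fin_num.
  by apply: fin_num_measure; exact: measurableI.
have := congr1 (fun z => z - P (D `&` B)) (esym H1).
by rewrite [in X in _ = X -> _]H2 ![P (D `&` B) + _]addeC !addeK.
Qed.

(** After resampling at [x] on both sides, the ratio turns [p] into [1 - p] and conversely, so the
    two terms change places. This is the only form in which the Markov property is used later. *)
Lemma flip_quasi_invariant x (F : Omega d -> \bar R) :
  measurable_fun [set: Omega d] F -> (forall w, 0 <= F w) ->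
  \int[P]_w (F (flip x w) * (flip_ratio x w)%:E) = \int[P]_w F w.
Proof.
move=> mF F0; rewrite (ising_integral x mF F0) (ising_integral x); last 2 first.
- apply: emeasurable_funM; last first.
    by apply/measurable_EFinP; exact: measurable_flip_ratio.
  exact: (measurableT_comp mF (measurable_flip x)).
- move=> w; apply: mule_ge0; first exact: F0.
  by rewrite lee_fin; apply/ltW/flip_ratio_gt0.
have fu b w : flip x (upd x b w) = upd x (~~ b) w.
  by apply/funext => y; rewrite /flip /upd; case: eqP.
rewrite addeC; congr (_ + _); apply: eq_integral => w _.
  rewrite fu -muleA -EFinM; congr (_ * _%:E).
  rewrite /flip_ratio nbr_sum_upd /spin /upd eqxx mulN1r mulrN opprK.
  set t := (2 * beta * J * nbr_sum R w x)%R.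
  rewrite /p -/t expRN; have := expR_gt0 t; move: (expR t) => e e0; field.
  by rewrite !gt_eqF // addr_gt0.
rewrite fu -muleA -EFinM; congr (_ * _%:E).
rewrite /flip_ratio nbr_sum_upd /spin /upd eqxx mul1r.
set t := (2 * beta * J * nbr_sum R w x)%R.
rewrite /p -/t expRN; have := expR_gt0 t; move: (expR t) => e e0; field.
by rewrite !gt_eqF // addr_gt0.
Qed.
End FlipRatio.

(** * Relaxation of the energy in a quadratic space *)

Section Relaxation.
Context (R : realFieldType) (V : lmodType R) (I : eqType).
Variables (H : V -> Prop) (ip : V -> V -> R) (D : I -> {linear V -> V}).
Hypothesis HD : forall f g, H f -> H g -> H (f + g).
Hypothesis HZ : forall c f, H f -> H (c *: f).
Hypothesis H0 : H 0.
Hypothesis HDx : forall x f, H f -> H (D x f).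
Hypothesis ipC : forall f g, ip f g = ip g f.
Hypothesis ipDl : forall f g h, H f -> H g -> H h -> ip (f + g) h = ip f h + ip g h.
Hypothesis ipZl : forall c f g, H f -> H g -> ip (c *: f) g = c * ip f g.
Hypothesis ip_ge0 : forall f, 0 <= ip f f.
(** With the symmetry of [ip], this is all that is needed of [D x] being an orthogonal projection.
    [H] will be square integrability: [ip] is bilinear there only, and it may vanish on nonzero
    functions. *)
Hypothesis ip_proj : forall x f g, H f -> H g -> ip (D x f) g = ip (D x f) (D x g).
Implicit Types (f g h : V) (c : R) (s : seq I).

Let HN f : H f -> H (- f). Proof. by rewrite -scaleN1r; exact: HZ. Qed.

Lemma form_subl f g h : H f -> H g -> H h -> ip (f - g) h = ip f h - ip g h.
Proof. by move=> *; rewrite ipDl // -?scaleN1r ?ipZl ?mulN1r //; exact: HZ. Qed.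

Lemma form_subr f g h : H f -> H g -> H h -> ip h (f - g) = ip h f - ip h g.
Proof. by move=> *; rewrite ipC form_subl // !(ipC h). Qed.

Lemma form_Zr c f g : H f -> H g -> ip g (c *: f) = c * ip g f.
Proof. by move=> *; rewrite ipC ipZl // ipC. Qed.

Let H_sum s (F : I -> V) : (forall x, H (F x)) -> H (\sum_(x <- s) F x).
Proof. by move=> HF; apply: big_ind => //. Qed.

Lemma form_suml s (F : I -> V) h : (forall x, H (F x)) -> H h ->
  ip (\sum_(x <- s) F x) h = \sum_(x <- s) ip (F x) h.
Proof.
move=> HF Hh; elim: s => [|x s IH].
  by rewrite !big_nil -(scale0r h) ipZl // mul0r.
by rewrite !big_cons ipDl ?IH //; exact: H_sum.
Qed.

Lemma form_sumr s (F : I -> V) h : (forall x, H (F x)) -> H h ->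
  ip h (\sum_(x <- s) F x) = \sum_(x <- s) ip h (F x).
Proof. by move=> *; rewrite ipC form_suml //; apply: eq_bigr => x _; rewrite ipC. Qed.

Lemma form_amgm f g : H f -> H g -> 2 * ip f g <= ip f f + ip g g.
Proof.
move=> Hf Hg; have := ip_ge0 (f - g).
rewrite form_subl // ?form_subr //; last exact/HD/HN.
by rewrite (ipC g f); lra.
Qed.

Lemma form_sqr_le f g : H f -> H g -> ip f f <= 2 * ip g g + 2 * ip (f - g) (f - g).
Proof.
move=> Hf Hg; have Hfg : H (f - g) by apply/HD/HN.
have := form_amgm Hg Hfg.
have -> : ip f f = ip g g + 2 * ip g (f - g) + ip (f - g) (f - g).
  by rewrite form_subl // ?form_subr // (ipC g f); ring.
by lra.
Qed.

Lemma form_sqr_sum_le s (F : I -> V) : (forall x, H (F x)) ->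
  ip (\sum_(x <- s) F x) (\sum_(x <- s) F x) <= (size s)%:R * \sum_(x <- s) ip (F x) (F x).
Proof.
move=> HF; rewrite form_suml //; last exact: H_sum.
have step x : ip (F x) (\sum_(y <- s) F y) <=
    (size s)%:R / 2 * ip (F x) (F x) + 2^-1 * \sum_(y <- s) ip (F y) (F y).
  rewrite form_sumr //.
  have -> : (size s)%:R / 2 * ip (F x) (F x) = \sum_(y <- s) (2^-1 * ip (F x) (F x)).
    by rewrite big_const_seq count_predT iter_addr addr0 -[RHS]mulr_natl mulrA.
  rewrite mulr_sumr -big_split /=; apply: ler_sum => y _.
  by have := form_amgm (HF x) (HF y); lra.
apply: le_trans (ler_sum _ (fun x _ => step x)) _.
rewrite big_split /= -mulr_sumr big_const_seq count_predT iter_addr addr0.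
rewrite -mulr_natl; set S := \sum_(_ <- _) _; set n : R := _%:R.
by rewrite le_eqVlt; apply/orP; left; apply/eqP; field.
Qed.

Variable (s : seq I) (gam : R).
Hypothesis s_neq0 : (0 < size s)%N.
Hypothesis gam_gt0 : 0 < gam.

Let N : R := (size s)%:R.
Let N_gt0 : 0 < N. Proof. by rewrite ltr0n. Qed.

Definition generator f : V := \sum_(x <- s) D x f.
Definition energy f : R := \sum_(x <- s) ip (D x f) (D x f).
(** The average over the sites of [s] of the projections [1 - D x], that is, one step of the
    heat-bath dynamics resampling a uniformly chosen site. *)
Definition relax f : V := f - (size s)%:R^-1 *: generator f.

Hypothesis curvature : forall f, H f ->
  gam * energy f <= ip (generator f) (generator f).

Lemma H_generator f : H f -> H (generator f).
Proof. by move=> Hf; apply: H_sum => x; exact: HDx. Qed.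

Lemma H_relax f : H f -> H (relax f).
Proof. by move=> Hf; apply/HD/HN/HZ/H_generator. Qed.

Lemma energy_ge0 f : 0 <= energy f.
Proof. by apply: sumr_ge0 => x _; exact: ip_ge0. Qed.

Lemma generator_sym f g : H f -> H g -> ip (generator f) g = ip (generator g) f.
Proof.
move=> Hf Hg; rewrite !form_suml //; try by move=> x; exact: HDx.
by apply: eq_bigr => x _; rewrite ip_proj // [RHS]ip_proj // ipC.
Qed.

Lemma energyE f : H f -> energy f = ip (generator f) f.
Proof.
move=> Hf; rewrite form_suml // => [|x]; last exact: HDx.
by apply: eq_bigr => x _; rewrite -ip_proj.
Qed.

Lemma generator_sqr_le f : H f ->
  ip (generator f) (generator f) <= N * energy f.
Proof. by move=> Hf; apply: form_sqr_sum_le => x; exact: HDx. Qed.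

Lemma energy_le f : H f -> energy f <= N * ip f f.
Proof.
move=> Hf; have -> : N * ip f f = \sum_(x <- s) ip f f.
  by rewrite big_const_seq count_predT iter_addr addr0 mulr_natl.
apply: ler_sum => x _.
have HDf := HDx x Hf.
have := ip_ge0 (f - D x f); rewrite form_subl ?form_subr //; last exact/HD/HN.
by rewrite (ipC f (D x f)) [ip (D x f) f]ip_proj // -subr_ge0; lra.
Qed.

Lemma relax_sqr f : H f -> ip (relax f) (relax f) =
  ip f f - 2 / N * energy f + N^-1 ^+ 2 * ip (generator f) (generator f).
Proof.
move=> Hf; have Hg := H_generator Hf; have HZg := HZ N^-1 Hg.
rewrite /relax -/N form_subl ?form_subr // ?ipZl ?form_Zr //; last exact/HD/HN.
by rewrite energyE // (ipC f); ring.
Qed.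

Lemma relax_contract f : H f -> ip (relax f) (relax f) <= ip f f.
Proof.
move=> Hf; rewrite relax_sqr //; have h := generator_sqr_le Hf.
have h2 : N^-1 ^+ 2 * ip (generator f) (generator f) <= N^-1 * energy f.
  apply: le_trans (ler_wpM2l (sqr_ge0 _) h) _.
  rewrite mulrA expr2 mulrVK ?unitfE ?gt_eqF //.
have : 0 <= N^-1 * energy f by rewrite mulr_ge0 ?energy_ge0 // invr_ge0 ltW.
by move: h2; set a := N^-1 ^+ 2 * _; lra.
Qed.

(** Expanding gives [energy f - (2 / N) |L f|^2 + energy (L f) / N^2]. Since
    [energy (L f) <= N |L f|^2], the loss is at least [|L f|^2 / N], which [curvature] bounds
    below. *)
Lemma energy_relax f : H f -> energy (relax f) <= energy f - gam / N * energy f.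
Proof.
move=> Hf; have Hg := H_generator Hf; have HZg := HZ N^-1 Hg.
have gE : generator (relax f) = generator f - N^-1 *: generator (generator f).
  rewrite /generator scaler_sumr -sumrB; apply: eq_bigr => x _.
  by rewrite /relax linearB linearZ.
have Hgg := H_generator Hg.
have HZgg := HZ N^-1 Hgg.
have -> : energy (relax f) = energy f - 2 / N * ip (generator f) (generator f)
    + N^-1 ^+ 2 * energy (generator f).
  rewrite energyE ?gE; last exact: H_relax.
  rewrite /relax -/N form_subl ?form_subr // ?ipZl ?form_Zr //; last exact/HD/HN.
  rewrite (generator_sym Hg Hf) !energyE //; ring.
have h := energy_le Hg; have h3 := curvature Hf.
have h2 : N^-1 ^+ 2 * energy (generator f) <= N^-1 * ip (generator f) (generator f).
  apply: le_trans (ler_wpM2l (sqr_ge0 _) h) _.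
  rewrite mulrA expr2 mulrVK ?unitfE ?gt_eqF //.
have h4 : gam / N * energy f <= N^-1 * ip (generator f) (generator f).
  by rewrite (mulrC gam) -mulrA; apply: ler_wpM2l => //; rewrite invr_ge0 ltW.
by move: h2 h4; set a := N^-1 ^+ 2 * _; set b := gam / N * _; lra.
Qed.

(** One step costs at most [(2 / N) * energy f] of the squared norm, and the energy drops by at
    least [gam / N] times itself. Comparing the cost with the drop gives a bound that telescopes, so
    that the number of steps and [N] both disappear. *)
Lemma relax_variance f : H f ->
  ip f f <= ip (relax f) (relax f) + 2 / gam * (energy f - energy (relax f)).
Proof.
move=> Hf; rewrite relax_sqr //.
have h : 2 / N * energy f <= 2 / gam * (energy f - energy (relax f)).
  have h1 : gam / N * energy f <= energy f - energy (relax f).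
    by have := energy_relax Hf; lra.
  have h2 : 0 <= 2 / gam by rewrite divr_ge0 // ltW.
  apply: le_trans (ler_wpM2l h2 h1); rewrite le_eqVlt; apply/orP; left; apply/eqP.
  by field; rewrite !gt_eqF.
have h3 : 0 <= N^-1 ^+ 2 * ip (generator f) (generator f).
  by rewrite mulr_ge0 ?sqr_ge0.
lra.
Qed.

Lemma iter_relax_variance k f : H f ->
  ip f f <= ip (iter k relax f) (iter k relax f) + 2 / gam * energy f.
Proof.
move=> Hf.
suff [Hk h] : H (iter k relax f) /\ ip f f <= ip (iter k relax f) (iter k relax f) +
    2 / gam * (energy f - energy (iter k relax f)).
  apply: le_trans h _; rewrite lerD2l; apply: ler_wpM2l.
    by rewrite divr_ge0 // ltW.
  by have := energy_ge0 (iter k relax f); lra.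
elim: k => [|k [Hk IH]] /=; first by rewrite subrr mulr0 addr0.
split; first exact: H_relax.
by apply: le_trans IH _; have := relax_variance Hk; lra.
Qed.

Lemma iter_relax_contract k f : H f ->
  ip (iter k relax f) (iter k relax f) <= ip f f.
Proof.
move=> Hf; suff [] : H (iter k relax f) /\
  ip (iter k relax f) (iter k relax f) <= ip f f by [].
elim: k => [|k [Hk IH]] //=; split; first exact: H_relax.
exact: le_trans (relax_contract Hk) IH.
Qed.

End Relaxation.

Section Curvature.
Context (R : realFieldType) (I : eqType).

(** Diagonal dominance: each [M x x] is charged [k] by at most [m] neighbours as a row and by at
    most [m] as a column, hence [2 k m]. *)
Lemma curvature_sum (s : seq I) (nb : rel I) (k : R) (m : nat) (M : I -> I -> R) :
  uniq s -> 0 <= k -> symmetric nb ->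
  (forall x, (count (nb x) s <= m)%N) -> (forall x, 0 <= M x x) ->
  (forall x y, x != y -> - (k * (nb x y)%:R) * (M x x + M y y) <= M x y) ->
  (1 - 2 * k * m%:R) * \sum_(x <- s) M x x <= \sum_(x <- s) \sum_(y <- s) M x y.
Proof.
move=> us k0 nbC deg M0 HM.
have step x : x \in s ->
    M x x - k * \sum_(y <- s) (nb x y)%:R * (M x x + M y y) <= \sum_(y <- s) M x y.
  move=> xs; rewrite [leRHS](bigD1_seq x) //= lerD2l -mulrN -sumrN mulr_sumr.
  rewrite [leLHS](bigD1_seq x) //= -[leRHS]add0r; apply: lerD.
    by rewrite mulrN oppr_le0 !mulr_ge0 // addr_ge0.
  by apply: ler_sum => y yx; rewrite mulrN mulrA -mulNr HM // eq_sym.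
have sum_nb (F : I -> R) x : \sum_(y <- s) (nb x y)%:R * F x = (count (nb x) s)%:R * F x.
  rewrite -mulr_suml -natr_sum -sum1_count [in RHS]big_mkcond /=.
  by congr (_%:R * _); apply: eq_bigr => y _; case: (nb x y).
apply: le_trans (_ : \sum_(x <- s) (M x x - k * \sum_(y <- s) (nb x y)%:R * (M x x + M y y)) <= _).
  rewrite sumrB -mulr_sumr mulrBl mul1r lerD2l lerN2.
  under eq_bigr => x _.
    under eq_bigr do rewrite mulrDr.
    rewrite big_split /=; over.
  rewrite big_split /= [X in _ * (_ + X)]exchange_big /=.
  under [X in _ * (_ + X)]eq_bigr => x _.
    under eq_bigr do rewrite nbC.
    over.
  rewrite [leRHS](_ : _ = k * (\sum_(x <- s) m%:R * M x x + \sum_(x <- s) m%:R * M x x)).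
    2: by rewrite -mulr_sumr; ring.
  apply: ler_wpM2l => //; apply: lerD; apply: ler_sum => x _;
    by rewrite (sum_nb (fun x => M x x)); apply: ler_wpM2r => //; rewrite ler_nat.
rewrite big_seq [leRHS]big_seq; exact: ler_sum.
Qed.
End Curvature.

(** * Square-integrable functions *)

Section SquareIntegrable.
Context {d : measure_display} {T : measurableType d} {R : realType} (P : probability T R).
Implicit Types (f g h : T -> R).

Definition sqr_integrable f :=
  measurable_fun [set: T] f /\ (\int[P]_w ((f w) ^+ 2)%:E < +oo)%E.

Definition l2dot f g : R := (\int[P]_w (f w * g w))%R.

Lemma integrable_EFin f : measurable_fun [set: T] f ->
  (\int[P]_w (`|f w|)%:E < +oo)%E -> P.-integrable setT (EFin \o f).
Proof.
by move=> mf H; apply/integrableP; split; first exact/measurable_EFinP.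
Qed.

Lemma sqr_integrable_sqr f : sqr_integrable f ->
  P.-integrable setT (EFin \o (fun w => f w ^+ 2)).
Proof.
case=> mf f2; apply: integrable_EFin; first exact: measurable_funX.
by under eq_integral do rewrite ger0_norm ?sqr_ge0 //.
Qed.

Lemma integrable_sqr f : measurable_fun [set: T] f ->
  P.-integrable setT (EFin \o (fun w => f w ^+ 2)) -> sqr_integrable f.
Proof.
move=> mf /integrableP[_ H]; split=> //; apply: le_lt_trans H.
by apply: ge0_le_integral => //=; [move=> w _; rewrite lee_fin sqr_ge0 |
  apply/measurable_EFinP; exact: measurable_funX |
  apply/measurable_EFinP; apply: measurableT_comp => //; exact: measurable_funX |
  move=> w _; rewrite lee_fin ler_norm].
Qed.

Lemma sqr_integrable_le f g : measurable_fun [set: T] f -> sqr_integrable g ->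
  (forall w, f w ^+ 2 <= g w ^+ 2) -> sqr_integrable f.
Proof.
move=> mf Hg H; split=> //; apply: le_lt_trans Hg.2.
apply: ge0_le_integral => //=.
- by move=> w _; rewrite lee_fin sqr_ge0.
- by apply/measurable_EFinP; exact: measurable_funX.
- by apply/measurable_EFinP; apply: measurable_funX; exact: Hg.1.
- by move=> w _; rewrite lee_fin.
Qed.

Lemma integrable_mul f g : sqr_integrable f -> sqr_integrable g ->
  P.-integrable setT (EFin \o (fun w => f w * g w)).
Proof.
move=> Hf Hg.
apply: (@le_integrable _ _ _ _ _ _ _ (EFin \o (fun w => f w ^+ 2 + g w ^+ 2))) => //.
- by apply/measurable_EFinP; apply: measurable_funM; [exact: Hf.1 | exact: Hg.1].
- move=> w _ /=; rewrite lee_fin [leRHS]ger0_norm ?addr_ge0 ?sqr_ge0 //.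
  rewrite normrM -(real_normK (num_real (f w))) -(real_normK (num_real (g w))).
  have := sqr_ge0 (`|f w| - `|g w|); have := normr_ge0 (f w); have := normr_ge0 (g w).
  by nra.
- have := integrableD measurableT (sqr_integrable_sqr Hf) (sqr_integrable_sqr Hg).
  by apply: eq_integrable => // w _ /=; rewrite EFinD.
Qed.

Lemma sqr_integrable_cst c : sqr_integrable (fun=> c).
Proof.
split=> //; rewrite integral_cst //= probability_setT mule1; exact: ltry.
Qed.

Lemma sqr_integrableD f g : sqr_integrable f -> sqr_integrable g -> sqr_integrable (f + g).
Proof.
move=> Hf Hg; apply: integrable_sqr.
  by apply: measurable_funD; [exact: Hf.1 | exact: Hg.1].
have := integrableD measurableT (integrableD measurableT (sqr_integrable_sqr Hf) 
  (sqr_integrable_sqr Hg)) (integrableD measurableT (integrable_mul Hf Hg) (integrable_mul Hf Hg)).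
apply: eq_integrable => // w _ /=.
by rewrite -!EFinD fctE; congr EFin; ring.
Qed.

Lemma sqr_integrableZ c f : sqr_integrable f -> sqr_integrable (c *: f).
Proof.
move=> Hf; apply: integrable_sqr.
  by apply: measurable_funM => //; exact: Hf.1.
have := integrableZl measurableT (c ^+ 2) (sqr_integrable_sqr Hf).
by apply: eq_integrable => // w _ /=; rewrite -EFinM fctE exprMn.
Qed.

Lemma sqr_integrable0 : sqr_integrable 0.
Proof. exact: sqr_integrable_cst. Qed.

Lemma sqr_integrableB f g : sqr_integrable f -> sqr_integrable g -> sqr_integrable (f - g).
Proof.
by move=> Hf Hg; rewrite -scaleN1r; apply: sqr_integrableD => //; exact: sqr_integrableZ.
Qed.

Lemma sqr_integrable_integrable f : sqr_integrable f -> P.-integrable setT (EFin \o f).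
Proof.
move=> Hf; have := integrable_mul Hf (sqr_integrable_cst 1).
by apply: eq_integrable => // w _ /=; rewrite mulr1.
Qed.

Lemma l2dotC f g : l2dot f g = l2dot g f.
Proof. by apply: eq_Rintegral => w _; rewrite mulrC. Qed.

Lemma l2dotDl f g h : sqr_integrable f -> sqr_integrable g -> sqr_integrable h ->
  l2dot (f + g) h = l2dot f h + l2dot g h.
Proof.
move=> Hf Hg Hh; rewrite /l2dot -RintegralD //; try exact: integrable_mul.
by apply: eq_Rintegral => w _; rewrite fctE mulrDl.
Qed.

Lemma l2dotZl c f g : sqr_integrable f -> sqr_integrable g ->
  l2dot (c *: f) g = c * l2dot f g.
Proof.
move=> Hf Hg; rewrite /l2dot -RintegralZl //; try exact: integrable_mul.
by apply: eq_Rintegral => w _; rewrite fctE mulrA.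
Qed.

Lemma l2dot_ge0 f : 0 <= l2dot f f.
Proof. by apply: Rintegral_ge0 => w _; rewrite -expr2 sqr_ge0. Qed.

Lemma l2dotE f : sqr_integrable f -> (l2dot f f)%:E = (\int[P]_w ((f w) ^+ 2)%:E)%E.
Proof.
move=> Hf; rewrite /l2dot /Rintegral.
under eq_integral do rewrite -expr2.
rewrite fineK // ge0_fin_numE; first exact: Hf.2.
by apply: integral_ge0 => w _; rewrite lee_fin sqr_ge0.
Qed.

Lemma l2dot_le f g : sqr_integrable f -> sqr_integrable g ->
  (forall w, f w ^+ 2 <= g w ^+ 2) -> l2dot f f <= l2dot g g.
Proof.
move=> Hf Hg H; apply: le_Rintegral => //; try exact: integrable_mul.
by move=> w _; rewrite -!expr2.
Qed.

(** The arithmetic-geometric inequality for [f] and the constant function equal to its mean. *)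
Lemma Rintegral_mean_sqr f : sqr_integrable f -> (\int[P]_w f w) ^+ 2 <= l2dot f f.
Proof.
move=> Hf; set m := (\int[P]_w f w)%R.
have := @form_amgm _ _ sqr_integrable l2dot sqr_integrableD sqr_integrableZ l2dotC
  l2dotDl l2dotZl l2dot_ge0 f (cst m) Hf (sqr_integrable_cst m).
have -> : l2dot f (cst m) = m ^+ 2.
  by rewrite /l2dot RintegralZr // ?expr2 //; exact: sqr_integrable_integrable.
have -> : l2dot (cst m) (cst m) = m ^+ 2.
  rewrite /l2dot -[X in Rintegral _ _ X]/(fun=> m * m).
  by rewrite Rintegral_cst //= probability_setT mulr1 expr2.
lra.
Qed.

End SquareIntegrable.

(** * Single-site fluctuations *)

Section Glauber.
Context (d : nat) (R : realType) (P : probability (Omega d) R).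
(* [r x w] plays the role of the ratio of the weights of [flip x w] and [w]. *)
Variables (r : site d -> Omega d -> R) (lam : R).
Hypothesis r_gt0 : forall x w, 0 < r x w.
Hypothesis mr : forall x, measurable_fun [set: Omega d] (r x).
Hypothesis r_flip : forall x w, r x (flip x w) * r x w = 1.
Hypothesis r_comm : forall x y w, x != y ->
  r x w * r y (flip x w) = r y w * r x (flip y w).
Hypothesis r_nonadj : forall x y w, x != y -> x \notin nbrs y -> r y (flip x w) = r y w.
Hypothesis r_le : forall x y w, x != y -> r y (flip x w) <= lam * r y w.
Hypothesis lam_ge1 : 1 <= lam.
Hypothesis r_inv : forall x (F : Omega d -> \bar R),
  measurable_fun [set: Omega d] F -> (forall w, 0 <= F w)%E ->
  (\int[P]_w (F (flip x w) * (r x w)%:E) = \int[P]_w F w)%E.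
Implicit Types (x y : site d) (w : Omega d) (f g u v F H : Omega d -> R).
Local Notation integrable F := (P.-integrable [set: Omega d] (EFin \o F)).
Local Notation L2 := (sqr_integrable P).

Lemma r_neq0 x w : r x w != 0.
Proof. by rewrite gt_eqF. Qed.

Lemma add1r_gt0 x w : 0 < 1 + r x w.
Proof. by rewrite addr_gt0. Qed.

Lemma add1r_neq0 x w : 1 + r x w != 0.
Proof. by rewrite gt_eqF // add1r_gt0. Qed.

Lemma r_flipE x w : r x (flip x w) = (r x w)^-1.
Proof. by rewrite -[LHS](mulfK (r_neq0 x w)) r_flip mul1r. Qed.

Lemma measurable_fun_flip x F : measurable_fun [set: Omega d] F ->
  measurable_fun [set: Omega d] (fun w => F (flip x w)).
Proof. by move=> mF; exact: (measurableT_comp mF (measurable_flip x)). Qed.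

Lemma integrable_measurable F : integrable F -> measurable_fun [set: Omega d] F.
Proof. by move=> /integrableP[/measurable_EFinP]. Qed.

Lemma integrable_flip x F : integrable F -> integrable (fun w => F (flip x w) * r x w).
Proof.
move=> iF; have mF := integrable_measurable iF; have [_ fF] := integrableP _ _ _ iF.
apply: integrable_EFin.
  by apply: measurable_funM => //; exact: measurable_fun_flip.
under eq_integral => w _ do rewrite normrM (gtr0_norm (r_gt0 x w)) EFinM.
rewrite (r_inv x (F := fun w => (`|F w|)%:E)) //.
by apply/measurable_EFinP; exact: measurableT_comp.
Qed.

Lemma Rintegral_flip x F : integrable F ->
  (\int[P]_w (F (flip x w) * r x w) = \int[P]_w F w)%R.
Proof.
move=> iF.
have nonneg G : integrable G -> (forall w, 0 <= G w) ->
    (\int[P]_w (G (flip x w) * r x w) = \int[P]_w G w)%R.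
  move=> iG G0; rewrite /Rintegral; congr fine.
  under eq_integral => w _ do rewrite EFinM.
  rewrite (r_inv x (F := EFin \o G)) //.
  by apply/measurable_EFinP; exact: integrable_measurable.
have iA : integrable (fun w => `|F w|) by exact: integrable_norm.
have iS : integrable (fun w => `|F w| + F w).
  by have := integrableD measurableT iA iF; apply: eq_integrable.
have HS := nonneg _ iS _; have HA := nonneg _ iA _.
(* The invariance is known for nonnegative functions, so [F] is written as a difference of two such
   functions, both integrable. *)
have -> : (\int[P]_w F w = \int[P]_w (`|F w| + F w) - \int[P]_w `|F w|)%R.
  by rewrite -RintegralB //; apply: eq_Rintegral => w _; ring.
rewrite -HS => [|w]; last first.
  by have := ler_norm (- F w); rewrite normrN; lra.
have jA := integrable_flip x iA; have jS := integrable_flip x iS.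
by rewrite -HA // -RintegralB //; apply: eq_Rintegral => w _; ring.
Qed.

Lemma integrable_bounded_mul F u : integrable F -> measurable_fun [set: Omega d] u ->
  (forall w, 0 <= u w) -> (forall w, u w <= 1) -> integrable (fun w => F w * u w).
Proof.
move=> iF mu u0 u1; have mF := integrable_measurable iF.
apply: le_integrable iF => //; first exact/measurable_EFinP/measurable_funM.
move=> w _ /=; rewrite lee_fin normrM (ger0_norm (u0 w)) -[leRHS]mulr1.
exact: ler_wpM2l.
Qed.

(** The hypothesis says that the conditional mean of [H] given the spins off [x] vanishes. The
    weights [u] and [1 - u] are the conditional probabilities of [w] and [flip x w]; changing
    variables in the second half of [H = H u + H (1 - u)] makes the hypothesis appear under the
    integral. *)
Lemma Rintegral_site0 x H : integrable H ->
  (forall w, H w + r x w * H (flip x w) = 0) -> (\int[P]_w H w = 0)%R.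
Proof.
move=> iH H0; pose u w := (1 + r x w)^-1.
have mu : measurable_fun [set: Omega d] u.
  by apply: measurable_inv_gt0; [exact: measurable_funD | move=> w; exact: add1r_gt0].
have u0 w : 0 <= u w by rewrite invr_ge0 ltW // add1r_gt0.
have u1 w : u w <= 1 by rewrite invf_le1 ?add1r_gt0 // lerDl ltW.
have ru w : r x w * u w = 1 - u w by rewrite /u; field; exact: add1r_neq0.
have i1 := integrable_bounded_mul iH mu u0 u1.
have i2 : integrable (fun w => H w * (1 - u w)).
  apply: integrable_bounded_mul => //; first exact: measurable_funB.
  - by move=> w; rewrite subr_ge0.
  - by move=> w; rewrite gerBl.
have -> : (\int[P]_w H w = \int[P]_w (H w * u w) + \int[P]_w (H w * (1 - u w)))%R.
  by rewrite -RintegralD //; apply: eq_Rintegral => w _; rewrite -mulrDr addrC subrK mulr1.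
have j2 := integrable_flip x i2.
rewrite -(Rintegral_flip x i2) -RintegralD //.
rewrite (_ : (fun w => _) = cst 0); first by rewrite Rintegral_cst // mul0r.
apply/funext => w /=; rewrite -(ru (flip x w)) /u r_flipE.
transitivity ((H w + r x w * H (flip x w)) * (1 + r x w)^-1).
  by field; rewrite add1r_neq0 r_neq0 // addrC add1r_neq0.
by rewrite H0 mul0r.
Qed.

(** The same argument for two spins: [1], [a], [b], [c] are the relative weights of the four
    configurations and [u] normalises them. [H] is cut into four pieces, and each is moved by the
    corresponding flips. *)
Lemma Rintegral_pair_ge0 x y H : x != y -> integrable H ->
  (forall w, 0 <= H w + r x w * H (flip x w) + r y w * H (flip y w) +
      r x w * r y (flip x w) * H (flip x (flip y w))) ->
  (0 <= \int[P]_w H w)%R.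
Proof.
move=> xy iH H0.
pose a w := r x w; pose b w := r y w; pose c w := r x w * r y (flip x w).
have c0 w : 0 < c w by rewrite mulr_gt0.
pose u w := (1 + a w + b w + c w)^-1.
have W0 w : 0 < 1 + a w + b w + c w by rewrite !addr_gt0 // /a /b.
have Wn w : 1 + a w + b w + c w != 0 by rewrite gt_eqF.
have mc : measurable_fun [set: Omega d] c.
  by apply: measurable_funM => //; exact: measurable_fun_flip.
have mu : measurable_fun [set: Omega d] u.
  by apply: measurable_inv_gt0 => //; do !apply: measurable_funD => //; exact: mr.
have u0 w : 0 < u w by rewrite invr_gt0.
have ma : measurable_fun [set: Omega d] a by exact: mr.
have mb : measurable_fun [set: Omega d] b by exact: mr.
have part v : measurable_fun [set: Omega d] v -> (forall w, 0 < v w) ->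
    (forall w, v w <= 1 + a w + b w + c w) -> integrable (fun w => H w * (v w * u w)).
  move=> mv v0 v1; apply: integrable_bounded_mul => //.
  - exact: measurable_funM.
  - by move=> w; rewrite ltW // mulr_gt0.
  - by move=> w; rewrite ler_pdivrMr // mul1r.
have ab0 w : 0 < a w /\ 0 < b w by rewrite /a /b !r_gt0.
have i0 : integrable (fun w => H w * (1 * u w)).
  by apply: part => // w; have [] := ab0 w; have := c0 w; lra.
have i1 : integrable (fun w => H w * (a w * u w)).
  by apply: part => // w; have [] := ab0 w; have := c0 w; lra.
have i2 : integrable (fun w => H w * (b w * u w)).
  by apply: part => // w; have [] := ab0 w; have := c0 w; lra.
have i3 : integrable (fun w => H w * (c w * u w)).
  by apply: part => // w; have [] := ab0 w; have := c0 w; lra.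
(* Seen from [flip x w], all four weights are divided by [a w], hence the normaliser is multiplied
   by it. *)
have ux w : u (flip x w) = a w * u w.
  have -> : u w = (a w * (u (flip x w))^-1)^-1.
    by rewrite /u invrK /a /b /c flipK r_flipE; congr (_^-1); field; exact: r_neq0.
  by rewrite invfM invrK mulrA mulfV ?mul1r // /a r_neq0.
have uy w : u (flip y w) = b w * u w.
  have yx : y != x by rewrite eq_sym.
  have -> : u w = (b w * (u (flip y w))^-1)^-1.
    rewrite /u invrK /a /b /c (r_comm w xy) (r_comm (flip y w) xy) flipK r_flipE.
    by congr (_^-1); field; exact: r_neq0.
  by rewrite invfM invrK mulrA mulfV ?mul1r // /b r_neq0.
have E1 : (\int[P]_w (H w * (a w * u w)) = \int[P]_w (H (flip x w) * (a w * u w)))%R.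
  rewrite -(Rintegral_flip x i1); apply: eq_Rintegral => w _.
  by rewrite ux /a -[RHS]mulr1 -(r_flip x w); ring.
have E2 : (\int[P]_w (H w * (b w * u w)) = \int[P]_w (H (flip y w) * (b w * u w)))%R.
  rewrite -(Rintegral_flip y i2); apply: eq_Rintegral => w _.
  by rewrite uy /b -[RHS]mulr1 -(r_flip y w); ring.
have cx w : c (flip x w) * u (flip x w) * r x w = b w * (a w * u w).
  by rewrite ux /c /a /b flipK -[RHS]mulr1 -(r_flip x w); ring.
(* The double flip is carried out in two changes of variables, at [x] and then at [y]; [G] is the
   integrand in between. *)
pose G w := H (flip x w) * (b w * (a w * u w)).
have jG : integrable G.
  have := integrable_flip x i3; apply: eq_integrable => // w _ /=.
  by rewrite /G -cx; congr EFin; ring.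
have jG' : integrable (fun w => H (flip x (flip y w)) * (c w * u w)) /\
  (\int[P]_w (H w * (c w * u w)) = \int[P]_w (H (flip x (flip y w)) * (c w * u w)))%R.
  have GE w : G (flip y w) * r y w = H (flip x (flip y w)) * (c w * u w).
    by rewrite /G uy /c r_comm // /a /b -[RHS]mulr1 -(r_flip y w); ring.
  split.
    have := integrable_flip y jG; apply: eq_integrable => // w _ /=.
    by rewrite GE.
  rewrite -(Rintegral_flip x i3).
  transitivity (\int[P]_w G w)%R.
    by apply: eq_Rintegral => w _; rewrite /G -cx; ring.
  by rewrite -(Rintegral_flip y jG); apply: eq_Rintegral => w _; rewrite GE.
have [j3 E3] := jG'.
have j1 : integrable (fun w => H (flip x w) * (a w * u w)).
  have := integrable_flip x i1; apply: eq_integrable => // w _ /=.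
  by rewrite ux /a -[X in _ = EFin X]mulr1 -(r_flip x w); congr EFin; ring.
have j2 : integrable (fun w => H (flip y w) * (b w * u w)).
  have := integrable_flip y i2; apply: eq_integrable => // w _ /=.
  by rewrite uy /b -[X in _ = EFin X]mulr1 -(r_flip y w); congr EFin; ring.
have iadd F F' : integrable F -> integrable F' -> integrable (fun w => F w + F' w).
  by move=> iF iF'; have := integrableD measurableT iF iF'; apply: eq_integrable.
have -> : (\int[P]_w H w =
    \int[P]_w (H w * (1 * u w) + H w * (a w * u w) + H w * (b w * u w) + H w * (c w * u w)))%R.
  apply: eq_Rintegral => w _; have Wu : (1 + a w + b w + c w) * u w = 1 by rewrite /u mulfV.
  transitivity (H w * ((1 + a w + b w + c w) * u w)); last by ring.
  by rewrite Wu mulr1.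
have i01 := iadd _ _ i0 i1; have i012 := iadd _ _ i01 i2.
have j01 := iadd _ _ i0 j1; have j012 := iadd _ _ j01 j2.
rewrite (RintegralD _ i012 i3) // (RintegralD _ i01 i2) // (RintegralD _ i0 i1) //.
rewrite E1 E2 E3 -(RintegralD _ i0 j1) // -(RintegralD _ j01 j2) //.
rewrite -(RintegralD _ j012 j3) //.
apply: Rintegral_ge0 => w _.
rewrite [leRHS](_ : _ = u w * (H w + r x w * H (flip x w) + r y w * H (flip y w) +
      r x w * r y (flip x w) * H (flip x (flip y w)))); last by rewrite /a /b /c; ring.
by rewrite mulr_ge0 // ltW.
Qed.


(* [f] minus its conditional expectation given the spins off [x], since
   [r x w / (1 + r x w)] is the conditional probability of [flip x w]. *)
Definition fluct x f : Omega d -> R :=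
  fun w => r x w / (1 + r x w) * (f w - f (flip x w)).

Lemma fluct_is_linear x : linear (fluct x).
Proof.
move=> c f g; apply/funext => w.
have E u v w' : (c *: u + v) w' = c * u w' + v w' by [].
by rewrite E /fluct !E; ring.
Qed.

HB.instance Definition _ x := GRing.isLinear.Build R (Omega d -> R) (Omega d -> R) _
  (fluct x) (fluct_is_linear x).

Lemma fluct_flip x f w :
  fluct x f (flip x w) = (1 + r x w)^-1 * (f (flip x w) - f w).
Proof.
rewrite /fluct flipK r_flipE; congr (_ * _); field.
by rewrite ?r_neq0 ?add1r_neq0 ?(addrC (r x w)) ?add1r_neq0.
Qed.

Lemma weight_lt1 x w : 0 < r x w / (1 + r x w) < 1.
Proof.
apply/andP; split; first by rewrite divr_gt0 // add1r_gt0.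
by rewrite ltr_pdivrMr ?add1r_gt0 // mul1r ltrDr.
Qed.

Lemma measurable_weight x : measurable_fun [set: Omega d] (fun w => r x w / (1 + r x w)).
Proof.
apply: measurable_funM => //; apply: measurable_inv_gt0.
  by apply: measurable_funD.
by move=> w; exact: add1r_gt0.
Qed.

Lemma measurable_fluct x f : measurable_fun [set: Omega d] f ->
  measurable_fun [set: Omega d] (fluct x f).
Proof.
move=> mf; apply: measurable_funM; first exact: measurable_weight.
by apply: measurable_funB => //; exact: measurable_fun_flip.
Qed.

(** A flip does not preserve [P], so the square of [f] composed with the flip is controlled only
    against the density [r x]. The conditional weight supplies it: its square is at most [r x]. *)
Lemma sqr_integrable_fluct x f : L2 f -> L2 (fluct x f).
Proof.
move=> Hf; have [mf f2] := Hf.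
pose m w := r x w / (1 + r x w).
have m0 w : 0 < m w by have /andP[] := weight_lt1 x w.
have m1 w : m w < 1 by have /andP[] := weight_lt1 x w.
have mm : measurable_fun [set: Omega d] m by exact: measurable_weight.
have mr_le w : m w ^+ 2 <= r x w.
  have h : m w <= r x w.
    by rewrite ler_pdivrMr ?add1r_gt0 // mulrDr mulr1 lerDl -expr2 sqr_ge0.
  apply: le_trans h; rewrite expr2 -[leRHS]mulr1; apply: ler_wpM2l; exact: ltW.
have H1 : L2 (fun w => m w * f w).
  apply: (sqr_integrable_le _ Hf); first exact: measurable_funM.
  move=> w; rewrite exprMn -[leRHS]mul1r; apply: ler_wpM2r; first exact: sqr_ge0.
  by rewrite expr_le1 // ltW.
have H2 : L2 (fun w => m w * f (flip x w)).
  split; first by apply: measurable_funM => //; exact: measurable_fun_flip.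
  apply: le_lt_trans f2.
  rewrite -(r_inv x (F := fun w => (f w ^+ 2)%:E)); last 2 first.
  - by apply/measurable_EFinP; exact: measurable_funX.
  - by move=> w; rewrite lee_fin sqr_ge0.
  apply: ge0_le_integral => //=.
  - by move=> w _; rewrite lee_fin sqr_ge0.
  - apply/measurable_EFinP; apply: measurable_funX; apply: measurable_funM => //.
    exact: measurable_fun_flip.
  - apply/measurable_EFinP; apply: measurable_funM => //; apply: measurable_funX.
    exact: measurable_fun_flip.
  - by move=> w _; rewrite lee_fin exprMn mulrC; apply: ler_wpM2l => //; exact: sqr_ge0.
have -> : fluct x f = (fun w => m w * f w) - (fun w => m w * f (flip x w)).
  by apply/funext => w; rewrite fctE /fluct mulrBr.
exact: sqr_integrableB.
Qed.

(** [g - fluct x g] does not change under a flip at [x], whereas [fluct x f] has mean zero over that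
    spin; the product therefore satisfies the criterion [Rintegral_site0]. *)
Lemma l2dot_fluct_proj x f g : L2 f -> L2 g ->
  l2dot P (fluct x f) g = l2dot P (fluct x f) (fluct x g).
Proof.
move=> Hf Hg; have Hx := sqr_integrable_fluct x Hf.
have Hgx := sqr_integrable_fluct x Hg.
apply/eqP; rewrite -subr_eq0; apply/eqP; rewrite /l2dot -RintegralB //;
  try exact: integrable_mul.
apply: (Rintegral_site0 (x := x)).
  have := integrableB measurableT (integrable_mul Hx Hg) (integrable_mul Hx Hgx).
  by apply: eq_integrable => // w _ /=; rewrite -EFinB.
move=> w; rewrite !fluct_flip /fluct.
by field; exact: add1r_neq0.
Qed.

Lemma l2dot_fluct_le x f : L2 f ->
  ((l2dot P (fluct x f) (fluct x f))%:E <= \int[P]_w ((f (flip x w) - f w) ^+ 2)%:E)%E.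
Proof.
move=> Hf; have Hx := sqr_integrable_fluct x Hf; rewrite l2dotE //.
have mf := Hf.1; have mfl := measurable_fun_flip x mf.
apply: ge0_le_integral => //=.
- by move=> w _; rewrite lee_fin sqr_ge0.
- by apply/measurable_EFinP; apply: measurable_funX; exact: measurable_fluct.
- by apply/measurable_EFinP; apply: measurable_funX; exact: measurable_funB.
- move=> w _; rewrite lee_fin /fluct exprMn -opprB sqrrN -[leRHS]mul1r.
  have /andP[h1 h2] := weight_lt1 x w.
  by apply: ler_wpM2r; rewrite ?sqr_ge0 // expr_le1 // ltW.
Qed.

Lemma l2dot_fluct_pair x y f : x != y -> L2 f ->
  - ((lam - 1) / 4 * (y \in nbrs x)%:R) *
    (l2dot P (fluct x f) (fluct x f) + l2dot P (fluct y f) (fluct y f)) <=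
  l2dot P (fluct x f) (fluct y f).
Proof.
move=> xy Hf; have Hx := sqr_integrable_fluct x Hf.
have Hy := sqr_integrable_fluct y Hf.
set k := (lam - 1) / 4 * _.
rewrite mulNr lerNl -subr_ge0 opprK addrC.
pose H w := fluct x f w * fluct y f w +
  k * (fluct x f w * fluct x f w + fluct y f w * fluct y f w).
have ixy := integrable_mul Hx Hy; have ixx := integrable_mul Hx Hx.
have iyy := integrable_mul Hy Hy.
have iS : integrable (fun w => fluct x f w * fluct x f w + fluct y f w * fluct y f w).
  by have := integrableD measurableT ixx iyy; apply: eq_integrable.
have ikS : integrable (fun w => k * (fluct x f w * fluct x f w + fluct y f w * fluct y f w)).
  by have := integrableZl measurableT k iS; apply: eq_integrable.
have iH : integrable H.
  by have := integrableD measurableT ixy ikS; apply: eq_integrable.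
have -> : l2dot P (fluct x f) (fluct y f) +
    k * (l2dot P (fluct x f) (fluct x f) + l2dot P (fluct y f) (fluct y f)) =
    (\int[P]_w H w)%R.
  by rewrite /l2dot -(RintegralD _ ixx iyy) // -(RintegralZl _ _ iS) // -(RintegralD _ ixy ikS).
apply: (Rintegral_pair_ge0 xy iH) => w.
set a := r x w; set b := r y w; set c := r y (flip x w); set e := r x (flip y w).
have [a0 b0 c0 e0] : [/\ 0 < a, 0 < b, 0 < c & 0 < e] by split; exact: r_gt0.
have ace : a * c = b * e by exact: r_comm.
set f1 := f w; set f2 := f (flip x w); set f3 := f (flip y w).
set f4 := f (flip x (flip y w)).
have x1 : fluct x f w = a / (1 + a) * (f1 - f2) by [].
have y1 : fluct y f w = b / (1 + b) * (f1 - f3) by [].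
have x2 : fluct x f (flip x w) = (1 + a)^-1 * (f2 - f1) by rewrite fluct_flip.
have y2 : fluct y f (flip x w) = c / (1 + c) * (f2 - f4).
  by rewrite /f4 flipC.
have x3 : fluct x f (flip y w) = e / (1 + e) * (f3 - f4) by [].
have y3 : fluct y f (flip y w) = (1 + b)^-1 * (f3 - f1) by rewrite fluct_flip.
have x4 : fluct x f (flip x (flip y w)) = (1 + e)^-1 * (f4 - f3) by rewrite fluct_flip.
have y4 : fluct y f (flip x (flip y w)) = (1 + c)^-1 * (f4 - f2).
  by rewrite flipC fluct_flip /f4 flipC.
(* Equal to [lam] for neighbours and to 1 otherwise, so that [two_site_bound] covers both cases;
   with 1 the error term vanishes and the form is nonnegative. *)
pose lam' := 1 + (lam - 1) * (y \in nbrs x)%:R.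
have kE : k = (lam' - 1) / 4 by rewrite /k /lam'; ring.
have bc : b <= lam' * c /\ c <= lam' * b.
  rewrite /lam'; case: (boolP (y \in nbrs x)) => nxy.
    rewrite mulr1 addrC subrK; split; last exact: r_le.
    by have := r_le (flip x w) xy; rewrite flipK.
  have -> : c = b by apply: r_nonadj => //; rewrite nbrs_sym.
  by rewrite mulr0 addr0 mul1r.
have lam1 : 1 <= lam' by rewrite /lam' lerDl mulr_ge0 // subr_ge0.
(* Weights relative to that of [w]. The last one is [a * c], equal to [b * e]: both orders of
   flipping lead to the same configuration. *)
have := @two_site_bound R lam' 1 a b (a * c) f1 f2 f3 f4 ltr01 a0 b0
  (mulr_gt0 a0 c0) lam1 _ _.
rewrite !mul1r !(mulrCA lam' a) => /(_ (ler_wpM2l (ltW a0) bc.1) (ler_wpM2l (ltW a0) bc.2)).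
have n1a : 1 + a != 0 by rewrite gt_eqF // addr_gt0.
have n1b : 1 + b != 0 by rewrite gt_eqF // addr_gt0.
have n1c : 1 + c != 0 by rewrite gt_eqF // addr_gt0.
have n1e : 1 + e != 0 by rewrite gt_eqF // addr_gt0.
rewrite /H x1 x2 x3 x4 y1 y2 y3 y4 /two_site_form /two_site_norm !mul1r -kE.
have an0 : a != 0 by rewrite gt_eqF.
have bn0 : b != 0 by rewrite gt_eqF.
have aE : a + a * c = a * (1 + c) by ring.
have bE : b + a * c = b * (1 + e) by rewrite ace; ring.
have -> : a * c / (a + a * c) = c / (1 + c) by rewrite aE -mulf_div divff ?mul1r.
have -> : a / (a + a * c) = (1 + c)^-1 by rewrite aE invfM mulrA divff ?mul1r.
have -> : a * c / (b + a * c) = e / (1 + e) by rewrite bE ace -mulf_div divff ?mul1r.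
have -> : b / (b + a * c) = (1 + e)^-1 by rewrite bE invfM mulrA divff ?mul1r.
move=> h; rewrite -subr_ge0 in h; apply: le_trans h _; rewrite le_eqVlt.
by apply/orP; left; apply/eqP; ring.
Qed.

End Glauber.

(** * Contraction of oscillations *)

Section Oscillation.
Context (d : nat) (R : realType).
Variables (r : site d -> Omega d -> R) (lam : R).
Hypothesis r_gt0 : forall x w, 0 < r x w.
Hypothesis r_flip : forall x w, r x (flip x w) * r x w = 1.
Hypothesis r_nonadj : forall x y w, x != y -> x \notin nbrs y -> r y (flip x w) = r y w.
Hypothesis r_le : forall x y w, x != y -> r y (flip x w) <= lam * r y w.
Hypothesis r_local : forall x w w', {in x :: nbrs x, w =1 w'} -> r x w = r x w'.
Hypothesis lam_ge1 : 1 <= lam.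
Implicit Types (x y : site d) (w : Omega d) (g : Omega d -> R) (s S : seq (site d))
  (del phi : site d -> R).

Definition osc_le g del := forall y w, `|g (flip y w) - g w| <= del y.

Definition depends_on S g := forall w w' : Omega d, {in S, w =1 w'} -> g w = g w'.

(** The function [1 / (1 + a)] changes by at most one quarter of the relative change of [a], because
    [4 u <= (1 + u)^2]. This is the influence of a site on the resampling probability of a
    neighbour. *)
Lemma inv_1r_diff (a b : R) : 0 < a -> 0 < b -> a <= lam * b -> b <= lam * a ->
  `|(1 + a)^-1 - (1 + b)^-1| <= (lam - 1) / 4.
Proof.
have main (u v : R) : 0 < u -> u <= v -> v <= lam * u ->
    (1 + u)^-1 - (1 + v)^-1 <= (lam - 1) / 4.
  move=> u0 uv h; have v0 : 0 < v by exact: lt_le_trans uv.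
  have pu : 0 < 1 + u by apply: addr_gt0.
  have pv : 0 < 1 + v by apply: addr_gt0.
  have -> : (1 + u)^-1 - (1 + v)^-1 = (v - u) / ((1 + u) * (1 + v)).
    by field; rewrite !gt_eqF.
  rewrite ler_pdivrMr ?mulr_gt0 // mulrAC ler_pdivlMr ?ltr0n //.
  have h1 : (v - u) <= (lam - 1) * u by lra.
  have h2 : u * 4 <= (1 + u) * (1 + v).
    apply: (@le_trans _ _ ((1 + u) * (1 + u))).
      by have := sqr_ge0 (1 - u); rewrite expr2; lra.
    by apply: ler_wpM2l; [exact: ltW | rewrite lerD2l].
  apply: le_trans (_ : (lam - 1) * u * 4 <= _); first by apply: ler_wpM2r.
  by rewrite -mulrA; apply: ler_wpM2l => //; rewrite subr_ge0.
move=> a0 b0 ab ba; rewrite ler_norml; apply/andP.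
have inv_le (u v : R) : 0 < u -> u <= v -> (1 + v)^-1 <= (1 + u)^-1.
  move=> u0 uv; have v0 : 0 < v by exact: lt_le_trans uv.
  by rewrite lef_pV2 ?posrE ?addr_gt0 // lerD2l.
have l0 : 0 <= (lam - 1) / 4 by rewrite divr_ge0 // subr_ge0.
have [le|/ltW le] := lerP a b.
  by have := main _ _ a0 le ba; have := inv_le _ _ a0 le; lra.
by have := main _ _ b0 le ab; have := inv_le _ _ b0 le; lra.
Qed.

Lemma site_averageE x g w :
  (g - fluct r x g) w = (1 + r x w)^-1 * g w + (1 - (1 + r x w)^-1) * g (flip x w).
Proof.
have -> : (g - fluct r x g) w = g w - fluct r x g w by [].
rewrite /fluct; field.
by rewrite gt_eqF // addr_gt0.
Qed.

(** Resampling at [x] erases the dependence on the spin at [x]. A flip at a neighbour [y] acts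
    directly, and also through the change it causes in the resampling probability, which costs the
    influence times the oscillation at [x]. *)
Lemma osc_site_average x g del : (forall y, 0 <= del y) -> osc_le g del ->
  osc_le (g - fluct r x g)
    (fun y => (y != x)%:R * del y + (lam - 1) / 4 * (y \in nbrs x)%:R * del x).
Proof.
move=> del0 Hg y w; rewrite !site_averageE.
have l0 : 0 <= (lam - 1) / 4 by rewrite divr_ge0 // subr_ge0.
have [->|yx] := eqVneq y x.
  rewrite flipK [X in `|X|](_ : _ = 0) ?normr0.
    by rewrite mul0r add0r mulr_ge0 // mulr_ge0.
  have -> : r x (flip x w) = (r x w)^-1.
    by rewrite -[LHS](mulfK (x := r x w)) ?r_flip ?mul1r // gt_eqF.
  field; rewrite ?(gt_eqF (r_gt0 x w)) /=.
  by rewrite ?(addrC (r x w)) gt_eqF // addr_gt0.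
set p := (1 + r x w)^-1; set q := (1 + r x (flip y w))^-1.
have p0 : 0 <= p by rewrite invr_ge0 ltW // addr_gt0.
have p1 : p <= 1 by rewrite invf_le1 ?addr_gt0 // lerDl ltW.
(* Direct effect averaged with the old probability [p], minus the change [q - p] of probability
   times an increment at [x]. *)
have -> : q * g (flip y w) + (1 - q) * g (flip x (flip y w)) - (p * g w + (1 - p) * g (flip x w)) =
    p * (g (flip y w) - g w) + (1 - p) * (g (flip y (flip x w)) - g (flip x w)) -
    (q - p) * (g (flip x (flip y w)) - g (flip y w)).
  by rewrite (flipC y x); ring.
rewrite mul1r; apply: le_trans (ler_normB _ _) _; apply: lerD.
  apply: le_trans (ler_normD _ _) _; rewrite !normrM (ger0_norm p0).
  have q0 : 0 <= 1 - p by rewrite subr_ge0.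
  rewrite (ger0_norm q0).
  by have := ler_wpM2l p0 (Hg y w); have := ler_wpM2l q0 (Hg y (flip x w)); lra.
rewrite normrM; case: (boolP (y \in nbrs x)) => nyx.
  rewrite mulr1; apply: (ler_pM (normr_ge0 _) (normr_ge0 _)); last exact: Hg x (flip y w).
  have xy := r_le w yx; have := r_le (flip y w) yx; rewrite flipK => yx'.
  exact: inv_1r_diff.
have -> : q = p by rewrite /q r_nonadj.
by rewrite subrr normr0 mulr0 !mul0r.
Qed.

Lemma osc_leD g g' del del' : osc_le g del -> osc_le g' del' ->
  osc_le (g + g') (fun y => del y + del' y).
Proof.
move=> H H' y w; rewrite !fctE opprD addrACA.
by apply: le_trans (ler_normD _ _) _; exact: lerD.
Qed.

Lemma osc_leZ c g del : 0 <= c -> osc_le g del -> osc_le (c *: g) (fun y => c * del y).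
Proof.
move=> c0 H y w; have E w' : (c *: g) w' = c * g w' by [].
by rewrite !E -mulrBr normrM (ger0_norm c0); apply: ler_wpM2l.
Qed.

Lemma osc_le_sum s (G : site d -> Omega d -> R) (Del : site d -> site d -> R) :
  (forall x, osc_le (G x) (Del x)) ->
  osc_le (\sum_(x <- s) G x) (fun y => \sum_(x <- s) Del x y).
Proof.
move=> HG; elim: s => [|x s IH].
  by move=> y w; rewrite !big_nil subrr normr0.
by move=> y w; rewrite !big_cons; exact: (osc_leD (HG x) IH y w).
Qed.

(** The spins of [w] on [S] are replaced by those of [w'] one site at a time; each replacement is a
    flip or changes nothing. *)
Lemma osc_total S g del : depends_on S g -> (forall y, 0 <= del y) -> osc_le g del ->
  forall w w', `|g w - g w'| <= \sum_(y <- S) del y.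
Proof.
move=> dS del0 Hg w w'.
pose mix (l : seq (site d)) : Omega d := fun y => if y \in l then w' y else w y.
have -> : g w' = g (mix S) by apply: dS => y yS; rewrite /mix yS.
have -> : g w = g (mix [::]) by apply: dS.
elim: S {dS} => [|x S IH]; first by rewrite subrr normr0 big_nil.
rewrite big_cons.
have -> : g (mix [::]) - g (mix (x :: S)) =
  (g (mix [::]) - g (mix S)) - (g (mix (x :: S)) - g (mix S)) by ring.
apply: le_trans (ler_normB _ _) _; rewrite addrC; apply: lerD => //.
case: (boolP (mix S x == w' x)) => E.
  rewrite (_ : mix (x :: S) = mix S) ?subrr ?normr0 //.
  apply/funext => y; rewrite /mix in_cons; have [->|//] := eqVneq y x.
  by move/eqP: E; rewrite /mix => ->.
rewrite (_ : mix (x :: S) = flip x (mix S)) ?Hg //.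
apply/funext => y; rewrite /flip /mix in_cons; have [->|//] := eqVneq y x.
by move: E; rewrite /mix /=; case: ifP => _; case: (w' x); case: (w x).
Qed.

Lemma depends_on_fluct S x g : x \in S -> {subset nbrs x <= S} ->
  depends_on S g -> depends_on S (fluct r x g).
Proof.
move=> xS nS dg w w' E; rewrite /fluct (dg _ _ E).
have -> : r x w = r x w'.
  by apply: r_local => y; rewrite in_cons => /orP[/eqP->|/nS]; exact: E.
by rewrite (dg (flip x w) (flip x w')) // => y yS; rewrite /flip E.
Qed.

Section FiniteVolume.
Variables (s S : seq (site d)) (phi : site d -> R).
Hypothesis us : uniq s.
Hypothesis s_neq0 : (0 < size s)%N.
Hypothesis sS : {subset s <= S}.
Hypothesis nS : forall x, x \in s -> {subset nbrs x <= S}.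
Hypothesis phi_gt0 : forall x, 0 < phi x.
Hypothesis phi_nbrs : forall x y, y \in nbrs x -> phi y <= 2 * phi x.

Local Notation T := (relax (fluct r) s).
Let N : R := (size s)%:R.
Let gam : R := 1 - d%:R * (lam - 1).
Let N_gt0 : 0 < N. Proof. by rewrite ltr0n. Qed.

Lemma relaxE g : T g = N^-1 *: \sum_(x <- s) (g - fluct r x g).
Proof.
rewrite /relax /generator sumrB scalerBr; congr (_ - _).
by rewrite big_const_seq count_predT iter_addr addr0 -scaler_nat scalerA mulVf ?scale1r // gt_eqF.
Qed.

Definition osc_step del : site d -> R := fun y => N^-1 *
  \sum_(x <- s) ((y != x)%:R * del y + (lam - 1) / 4 * (y \in nbrs x)%:R * del x).

Lemma osc_step_ge0 del : (forall y, 0 <= del y) -> forall y, 0 <= osc_step del y.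
Proof.
move=> del0 y; rewrite mulr_ge0 ?invr_ge0 ?(ltW N_gt0) //; apply: sumr_ge0 => x _.
by rewrite addr_ge0 ?mulr_ge0 ?divr_ge0 ?subr_ge0.
Qed.

Lemma osc_relax g del : (forall y, 0 <= del y) -> osc_le g del -> osc_le (T g) (osc_step del).
Proof.
move=> del0 Hg; rewrite relaxE; apply: osc_leZ; first by rewrite invr_ge0 ltW.
by apply: osc_le_sum => x; exact: osc_site_average.
Qed.

Lemma depends_on_relax g : depends_on S g -> depends_on S (T g).
Proof.
move=> dg w w' E; rewrite /relax !fctE (dg _ _ E); congr (_ - _ * _).
rewrite /generator !fct_sumE big_seq [RHS]big_seq; apply: eq_bigr => x xs.
by apply: (depends_on_fluct _ _ dg) => //; [exact: sS | exact: nS].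
Qed.

(** When [x] is resampled, [phi x * del x] is lost, and at most [2 d] neighbours of weight at most
    [2 phi x] each gain [(lam - 1) / 4 * del x]; the balance is a loss of [gam * phi x * del x]. The
    set [A] is left free because it will be both [s] and the larger [S]. *)
Lemma osc_step_sum A del : uniq A -> {subset s <= A} -> (forall y, 0 <= del y) ->
  \sum_(y <- A) phi y * osc_step del y <=
  \sum_(y <- A) phi y * del y - gam / N * \sum_(x <- s) phi x * del x.
Proof.
move=> uA sA del0; set M := \sum_(y <- A) phi y * del y.
have l0 : 0 <= (lam - 1) / 4 by rewrite divr_ge0 // subr_ge0.
have one x : x \in s ->
    \sum_(y <- A) phi y * ((y != x)%:R * del y + (lam - 1) / 4 * (y \in nbrs x)%:R * del x) <=
    M - gam * (phi x * del x).
  move=> xs; under eq_bigr do rewrite mulrDr; rewrite big_split /=.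
  have -> : \sum_(y <- A) phi y * ((y != x)%:R * del y) = M - phi x * del x.
    rewrite /M (bigD1_seq x) ?sA //= eqxx mul0r mulr0 add0r.
    rewrite [in RHS](bigD1_seq x) ?sA //= [RHS]addrAC subrr add0r.
    by apply: eq_bigr => y ->; rewrite mul1r.
  have h : \sum_(y <- A) phi y * ((lam - 1) / 4 * (y \in nbrs x)%:R * del x) <=
      d%:R * (lam - 1) * (phi x * del x).
    have -> : \sum_(y <- A) phi y * ((lam - 1) / 4 * (y \in nbrs x)%:R * del x) =
        (lam - 1) / 4 * del x * \sum_(y <- A | y \in nbrs x) phi y.
      rewrite mulr_sumr [RHS]big_mkcond; apply: eq_bigr => y _.
      by case: (y \in nbrs x); rewrite ?mulr1 ?mulr0 ?mul0r ?mulr0 // mulrC.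
    have h1 : \sum_(y <- A | y \in nbrs x) phi y <= (2 * d)%:R * (2 * phi x).
      apply: le_trans (_ : \sum_(y <- A | y \in nbrs x) 2 * phi x <= _).
        by apply: ler_sum => y; exact: phi_nbrs.
      rewrite big_const_seq iter_addr addr0 -[leLHS]mulr_natl; apply: ler_wpM2r.
        by rewrite mulr_ge0 // ltW.
      rewrite ler_nat -(size_nbrs x) -size_filter; apply: uniq_leq_size.
        exact: filter_uniq.
      by move=> y; rewrite mem_filter => /andP[].
    apply: le_trans (ler_wpM2l _ h1) _; first by rewrite mulr_ge0.
    by rewrite natrM le_eqVlt; apply/orP; left; apply/eqP; field.
  by rewrite /gam; lra.
have -> : \sum_(y <- A) phi y * osc_step del y = N^-1 * \sum_(x <- s) \sum_(y <- A)
    phi y * ((y != x)%:R * del y + (lam - 1) / 4 * (y \in nbrs x)%:R * del x).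
  rewrite exchange_big mulr_sumr /=; apply: eq_bigr => y _.
  by rewrite /osc_step mulrCA mulr_sumr.
apply: le_trans (_ : N^-1 * \sum_(x <- s) (M - gam * (phi x * del x)) <= _).
  apply: ler_wpM2l; first by rewrite invr_ge0 ltW.
  by rewrite big_seq [leRHS]big_seq; exact: ler_sum.
rewrite sumrB -mulr_sumr big_const_seq count_predT iter_addr addr0 -mulr_natl -/N.
rewrite mulrBr mulrA mulVf ?mul1r ?gt_eqF //.
by rewrite mulrA (mulrC N^-1).
Qed.

Lemma osc_iter k g del : (forall y, 0 <= del y) -> osc_le g del -> depends_on S g ->
  [/\ depends_on S (iter k T g), osc_le (iter k T g) (iter k osc_step del) &
      forall y, 0 <= iter k osc_step del y].
Proof.
move=> del0 Hg dg; elim: k => [|k [IH1 IH2 IH3]] //=; split.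
- exact: depends_on_relax.
- exact: osc_relax.
- exact: osc_step_ge0.
Qed.

Hypothesis gam_gt0 : 0 < gam.
Hypothesis uS : uniq S.

(** Sites of [S] outside [s] are never resampled, so their oscillation can accumulate; only the
    weighted total is kept under control. *)
Lemma osc_iter_outer k del : (forall y, 0 <= del y) ->
  \sum_(y <- S) phi y * iter k osc_step del y <= \sum_(y <- S) phi y * del y.
Proof.
move=> del0; suff [] : (forall y, 0 <= iter k osc_step del y) /\
  \sum_(y <- S) phi y * iter k osc_step del y <= \sum_(y <- S) phi y * del y by [].
elim: k => [|k [IH1 IH2]] //=; split; first exact: osc_step_ge0.
apply: le_trans (osc_step_sum uS sS IH1) _; apply: le_trans IH2.
rewrite gerBl; apply: mulr_ge0; first by rewrite divr_ge0 // ltW.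
by apply: sumr_ge0 => x _; rewrite mulr_ge0 // ltW.
Qed.

(** Sites outside [s] never pass their oscillation on, so the sum over [s] obeys a closed inequality
    and contracts strictly. *)
Lemma osc_iter_inner k del : (forall y, 0 <= del y) ->
  \sum_(y <- s) phi y * iter k osc_step del y <=
  (1 - gam / N) ^+ k * \sum_(y <- s) phi y * del y.
Proof.
move=> del0; have q0 : 0 <= 1 - gam / N.
  rewrite subr_ge0 ler_pdivrMr // mul1r.
  apply: (@le_trans _ _ 1); last by rewrite ler1n.
  by rewrite /gam gerBl mulr_ge0 // subr_ge0.
suff [] : (forall y, 0 <= iter k osc_step del y) /\
  \sum_(y <- s) phi y * iter k osc_step del y <=
  (1 - gam / N) ^+ k * \sum_(y <- s) phi y * del y by [].
elim: k => [|k [IH1 IH2]]; first by rewrite expr0 mul1r.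
split; first exact: osc_step_ge0.
apply: le_trans (osc_step_sum us (fun x xs => xs) IH1) _.
rewrite exprS -[leRHS]mulrA; apply: le_trans (ler_wpM2l q0 IH2).
by rewrite [leRHS]mulrBl mul1r lexx.
Qed.

End FiniteVolume.
End Oscillation.

Import numFieldNormedType.Exports.

(** * Layers around a finite support, and mixing of the iterates *)

Section Layers.
Context (d : nat).
Implicit Types (S : seq (site d)) (x y : site d).

Definition enlarge S := undup (S ++ flatten [seq nbrs x | x <- S]).

Lemma sub_enlarge S : {subset S <= enlarge S}.
Proof. by move=> x xS; rewrite mem_undup mem_cat xS. Qed.

Lemma nbrs_enlarge S x : x \in S -> {subset nbrs x <= enlarge S}.
Proof.
move=> xS y yx; rewrite mem_undup mem_cat; apply/orP; right.
by apply/flattenP; exists (nbrs x) => //; exact: map_f.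
Qed.

(** The origin is added so that the volume is nonempty even when [S] is: [relax] divides by its
    size. *)
Definition layer S n := iter n enlarge (undup (0 :: S)).

Lemma uniq_layer S n : uniq (layer S n).
Proof. by case: n => [|n]; rewrite /layer ?iterS; exact: undup_uniq. Qed.

Lemma layer_mono S m n : (m <= n)%N -> {subset layer S m <= layer S n}.
Proof.
move=> /subnK <-; elim: (n - m)%N => [|k IH] // x xm.
by rewrite addSn /=; apply/sub_enlarge/IH.
Qed.

Lemma size_layer_gt0 S n : (0 < size (layer S n))%N.
Proof.
have : 0 \in layer S n.
  by apply: (layer_mono (leq0n n)); rewrite mem_undup mem_head.
by case: (layer S n).
Qed.

(* The graph distance from [y] to [layer S 0], truncated at [n]. *)
Definition level S n y : nat := \sum_(k < n) (y \notin layer S k).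

Lemma level_nbrs S n x y : y \in nbrs x -> (level S n y <= (level S n x).+1)%N.
Proof.
move=> yx; case: n => [|n]; first by rewrite /level !big_ord0.
(* The sums are compared with a shift of one index: if [y] is outside layer [i + 1], its neighbour
   [x] is outside layer [i]. *)
rewrite /level big_ord_recl [X in (_ <= X.+1)%N]big_ord_recr /=.
apply: (@leq_trans (1 + \sum_(i < n) (x \notin layer S i))); last first.
  by rewrite add1n ltnS leq_addr.
apply: leq_add; first by case: (_ \notin _).
apply: leq_sum => i _; case: (boolP (x \in layer S i)) => xi; last by case: (_ \notin _).
rewrite leqn0 eqb0 negbK; exact: (nbrs_enlarge xi yx).
Qed.

Lemma level_in S n y : y \in layer S 0 -> level S n y = 0%N.
Proof.
by move=> y0; rewrite /level big1 // => i _; rewrite (layer_mono (leq0n i) y0).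
Qed.

Lemma level_out S n y : y \notin layer S n -> level S n.+1 y = n.+1.
Proof.
move=> yn; rewrite /level (eq_bigr (fun=> 1%N)) ?sum1_card ?card_ord // => i _.
have [yi|//] := boolP (y \in layer S i).
by rewrite (layer_mono _ yi) in yn => //; rewrite -ltnS.
Qed.

Lemma sum_layer (R : realType) S m n (F : site d -> R) : (m <= n)%N ->
  \sum_(y <- layer S n | y \in layer S m) F y = \sum_(y <- layer S m) F y.
Proof.
move=> mn; rewrite -big_filter; apply: perm_big; apply: uniq_perm.
- by rewrite filter_uniq // uniq_layer.
- exact: uniq_layer.
- move=> y; rewrite mem_filter andb_idr //; exact: layer_mono.
Qed.

End Layers.

Lemma geometric_small (R : realType) (q M e : R) : 0 <= q < 1 -> 0 <= M -> 0 < e ->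
  exists k, q ^+ k * M <= e.
Proof.
move=> /andP[q0 q1] M0 e0.
have M1 : 0 < M + 1 by rewrite ltr_wpDl.
have : q ^+ n @[n --> \oo] --> (0 : R) by apply: cvg_expr; rewrite ger0_norm.
move/cvgrPdist_lt => /(_ (e / (M + 1)) (divr_gt0 e0 M1)) [n _ H].
have := H n (leqnn n) => /=; rewrite sub0r normrN ger0_norm ?exprn_ge0 // => h.
exists n; apply: (@le_trans _ _ (e / (M + 1) * M)).
  by apply: ler_wpM2r => //; exact: ltW.
by rewrite mulrAC ler_pdivrMr // ler_wpM2l ?(ltW e0) // lerDl.
Qed.

Section Mixing.
Context (d : nat) (R : realType).
Variables (r : site d -> Omega d -> R) (lam : R).
Hypothesis r_gt0 : forall x w, 0 < r x w.
Hypothesis r_flip : forall x w, r x (flip x w) * r x w = 1.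
Hypothesis r_nonadj : forall x y w, x != y -> x \notin nbrs y -> r y (flip x w) = r y w.
Hypothesis r_le : forall x y w, x != y -> r y (flip x w) <= lam * r y w.
Hypothesis r_local : forall x w w', {in x :: nbrs x, w =1 w'} -> r x w = r x w'.
Hypothesis lam_ge1 : 1 <= lam.
Hypothesis lam_small : d%:R * (lam - 1) < 1.

(** The initial oscillation sits on level 0, where the weight is 1, so its weighted total is at most
    [M] whatever the volume. The number [n] of layers is chosen first, to make the boundary part
    small; it fixes [N], hence the contraction rate, and only then is [k] chosen for the inner
    part. *)
Lemma relax_mixing S (g : Omega d -> R) K e : depends_on S g ->
  (forall w, `|g w| <= K) -> 0 < e ->
  exists s k, [/\ uniq s, (0 < size s)%N &
    forall w w', `|iter k (relax (fluct r) s) g w - iter k (relax (fluct r) s) g w'| <= e].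
Proof.
move=> dS gK e0.
have K0 : 0 <= K by exact: le_trans (normr_ge0 _) (gK (fun=> true)).
pose M := 2 * K * (size (layer S 0))%:R.
have M0 : 0 <= M by rewrite !mulr_ge0.
have e2 : 0 < e / 2 by rewrite divr_gt0.
have half : 0 <= (2^-1 : R) < 1 by rewrite invr_ge0 ler0n invf_lt1 ?ltr1n.
have [n Hn] := geometric_small half M0 e2.
pose s := layer S n; pose S' := layer S n.+1.
pose phi y : R := 2 ^+ level S n.+1 y.
have phi_gt0 y : 0 < phi y by rewrite exprn_gt0.
have phi_ge1 y : 1 <= phi y by rewrite exprn_ege1 // ler1n.
have phi_nbrs x y : y \in nbrs x -> phi y <= 2 * phi x.
  by move=> yx; rewrite /phi -exprS ler_eXn2l ?ltr1n //; exact: level_nbrs.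
have s0 : (0 < size s)%N by exact: size_layer_gt0.
have us : uniq s by exact: uniq_layer.
have uS' : uniq S' by exact: uniq_layer.
have sS : {subset s <= S'} by exact: sub_enlarge.
have nS x : x \in s -> {subset nbrs x <= S'} by exact: nbrs_enlarge.
pose del y : R := 2 * K * (y \in layer S 0)%:R.
have del0 y : 0 <= del y by rewrite !mulr_ge0.
have Sl : {subset S <= layer S 0} by move=> y yS; rewrite mem_undup in_cons yS orbT.
have Hg : osc_le g del.
  move=> y w; rewrite /del; case: (boolP (y \in layer S 0)) => ys.
    rewrite mulr1 mulr_natl mulr2n; apply: le_trans (ler_normB _ _) _.
    by apply: lerD.
  rewrite (dS (flip y w) w) ?subrr ?normr0 ?mulr0 // => z zS.
  by rewrite /flip; case: eqP => // E; rewrite -E Sl in ys.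
have dS' : depends_on S' g.
  by move=> w w' E; apply: dS => z zS; apply: E; apply: (layer_mono (leq0n n.+1)); exact: Sl.
have outer0 m : \sum_(y <- layer S m) phi y * del y <= M.
  rewrite /del; under eq_bigr => y _ do rewrite mulrCA.
  rewrite -mulr_sumr; apply: ler_wpM2l; first by rewrite mulr_ge0.
  rewrite (eq_bigr (fun y => if y \in layer S 0 then 1 else 0)); last first.
    move=> y _; case: ifP => y0; last by rewrite mulr0.
    by rewrite /phi level_in // mulr1.
  have /= h := sum_layer S (fun=> 1 : R) (leq0n m).
  by rewrite -big_mkcond /= h big_const_seq count_predT iter_addr addr0.
pose N : R := (size s)%:R.
pose gam : R := 1 - d%:R * (lam - 1).
have N0 : 0 < N by rewrite ltr0n.
have gam0 : 0 < gam by rewrite subr_gt0.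
have q01 : 0 <= 1 - gam / N < 1.
  rewrite subr_ge0 ler_pdivrMr // mul1r gtrBl divr_gt0 // andbT.
  apply: (@le_trans _ _ 1); last by rewrite ler1n.
  by rewrite /gam gerBl mulr_ge0 // subr_ge0.
have [k Hk] := geometric_small q01 M0 e2.
exists s, k; split => // w w'.
have [dk Hgk delk] := osc_iter r_gt0 r_flip r_nonadj r_le r_local lam_ge1 s0 sS nS k del0 Hg dS'.
apply: le_trans (osc_total dk delk Hgk w w') _.
set del' := iter k _ del in delk Hgk *.
rewrite (bigID (fun y => y \in s)) /= sum_layer //.
have -> : e = e / 2 + e / 2 by field.
apply: lerD.
  apply: le_trans Hk; apply: (@le_trans _ _ (\sum_(y <- s) phi y * del' y)).
    by apply: ler_sum => y _; rewrite -[leLHS]mul1r; apply: ler_wpM2r.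
  apply: le_trans (osc_iter_inner lam_ge1 us s0 phi_gt0 phi_nbrs k del0) _.
  by apply: ler_wpM2l; [rewrite exprn_ge0 //; case/andP: q01 | exact: outer0].
apply: le_trans Hn.
(* Outside [s] the weight is [2 ^ n.+1], so dividing the weighted total by [2 ^ n] is enough. *)
apply: (@le_trans _ _ (2^-1 ^+ n * \sum_(y <- S') phi y * del' y)).
  rewrite mulr_sumr big_mkcond; apply: ler_sum => y _; case: ifP => ys; last first.
    by rewrite !mulr_ge0 ?exprn_ge0 ?invr_ge0 ?(ltW (phi_gt0 y)).
  rewrite mulrA -[leLHS]mul1r; apply: ler_wpM2r => //.
  rewrite /phi level_out // exprVn mulrC ler_pdivlMr ?exprn_gt0 // mul1r.
  by rewrite ler_eXn2l ?ltr1n.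
apply: ler_wpM2l; first by rewrite exprn_ge0 // invr_ge0.
apply: le_trans (osc_iter_outer lam_ge1 s0 sS phi_gt0 phi_nbrs gam0 uS' k del0) _.
exact: outer0.
Qed.

End Mixing.

From mathcomp Require Import finmap.

(** * Density of cylinder functions *)

Section CylinderDensity.
Context (d : nat) (R : realType) (P : probability (Omega d) R).
Implicit Types (f g h : Omega d -> R) (A B : set (Omega d)).
Local Notation L2 := (sqr_integrable P).

Definition cylinder g := measurable_fun [set: Omega d] g /\
  exists S K, depends_on S g /\ forall w, `|g w| <= K.

Lemma sqr_integrable_bounded g K : measurable_fun [set: Omega d] g ->
  (forall w, `|g w| <= K) -> L2 g.
Proof.
move=> mg gK; apply: (sqr_integrable_le mg (sqr_integrable_cst P K)) => w.
by rewrite -(real_normK (num_real (g w))) ler_sqr ?nnegrE // (le_trans _ (gK w)).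
Qed.

Lemma cylinder_L2 g : cylinder g -> L2 g.
Proof. by case=> mg [S [K [_ gK]]]; exact: sqr_integrable_bounded gK. Qed.

Lemma cylinder_op2 (op : R -> R -> R) g h : cylinder g -> cylinder h ->
  measurable_fun [set: Omega d] (fun w => op (g w) (h w)) ->
  (forall a b, `|op a b| <= `|a| + `|b|) ->
  cylinder (fun w => op (g w) (h w)).
Proof.
move=> [mg [S [K [dg gK]]]] [mh [S' [K' [dh hK]]]] mop Hop; split => //.
exists (S ++ S'), (K + K'); split=> [w w' E|w].
  rewrite (dg w w') ?(dh w w') // => y yS; apply: E; rewrite mem_cat yS ?orbT //.
by apply: le_trans (Hop _ _) _; apply: lerD.
Qed.

Definition approximable f := L2 f /\ forall e, 0 < e ->
  exists2 g, cylinder g & l2dot P (f - g) (f - g) < e.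

Let sqr_le f g : L2 f -> L2 g ->
  l2dot P f f <= 2 * l2dot P g g + 2 * l2dot P (f - g) (f - g).
Proof.
exact: (form_sqr_le (@sqr_integrableD _ _ _ P) (@sqr_integrableZ _ _ _ P)
  (@l2dotC _ _ _ P) (@l2dotDl _ _ _ P) (@l2dotZl _ _ _ P) (@l2dot_ge0 _ _ _ P)).
Qed.

Lemma approximable_cylinder g : cylinder g -> approximable g.
Proof.
move=> cg; split=> [|e e0]; first exact: cylinder_L2.
exists g => //; rewrite subrr /l2dot (_ : (fun _ => _) = cst 0).
  by rewrite Rintegral_cst // mul0r.
by apply/funext => w; rewrite mulr0.
Qed.

(** One argument for sum, difference and maximum: an operation that is 1-Lipschitz in its arguments
    carries approximants to approximants. The maximum is needed for unions of events. *)
Lemma approximable_op2 (op : R -> R -> R) f g : approximable f -> approximable g ->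
  (forall u v, measurable_fun [set: Omega d] u -> measurable_fun [set: Omega d] v ->
     measurable_fun [set: Omega d] (fun w => op (u w) (v w))) ->
  (forall a b, `|op a b| <= `|a| + `|b|) ->
  (forall a b a' b', `|op a b - op a' b'| <= `|a - a'| + `|b - b'|) ->
  approximable (fun w => op (f w) (g w)).
Proof.
move=> [Lf Hf] [Lg Hg] mop Hop Hop2.
have sq (a b c : R) : `|c| <= `|a| + `|b| -> c ^+ 2 <= (`|a| + `|b|) ^+ 2.
  by move=> h; rewrite -(real_normK (num_real c)) ler_sqr ?nnegrE // addr_ge0.
have Labs u : L2 u -> L2 (fun w => `|u w|).
  move=> Lu; apply: (sqr_integrable_le _ Lu); last by move=> w; rewrite real_normK ?num_real.
  by apply: measurableT_comp => //; exact: Lu.1.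
split.
  apply: (@sqr_integrable_le _ _ _ _ _ ((fun w => `|f w|) + (fun w => `|g w|))).
  - by apply: mop; [exact: Lf.1 | exact: Lg.1].
  - by apply: sqr_integrableD; exact: Labs.
  - by move=> w; exact: sq.
move=> e e0; have e4 : 0 < e / 4 by rewrite divr_gt0.
have [u cu Hu] := Hf _ e4; have [v cv Hv] := Hg _ e4.
have cop : cylinder (fun w => op (u w) (v w)).
  by apply: cylinder_op2 => //; apply: mop; [exact: cu.1 | exact: cv.1].
exists (fun w => op (u w) (v w)) => //.
have Lfu : L2 (f - u) by apply: sqr_integrableB => //; exact: cylinder_L2.
have Lgv : L2 (g - v) by apply: sqr_integrableB => //; exact: cylinder_L2.
have la := Labs _ Lfu; have lb := Labs _ Lgv.
have Lsum := sqr_integrableD la lb.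
have sqE k : l2dot P (fun w => `|k w|) (fun w => `|k w|) = l2dot P k k.
  by apply: eq_Rintegral => w _; rewrite -normrM ger0_norm // -expr2 sqr_ge0.
have bound := sqr_le Lsum la.
rewrite (addrC (fun w => `|_|)) addrK !sqE in bound.
apply: le_lt_trans (_ : 2 * l2dot P (f - u) (f - u) + 2 * l2dot P (g - v) (g - v) < _).
  apply: le_trans bound; apply: l2dot_le.
  - apply: sqr_integrableB; last exact: cylinder_L2.
    apply: (@sqr_integrable_le _ _ _ _ _ ((fun w => `|f w|) + (fun w => `|g w|))).
    + by apply: mop; [exact: Lf.1 | exact: Lg.1].
    + by apply: sqr_integrableD; exact: Labs.
    + by move=> w; exact: sq.
  - by rewrite addrC.
  - by move=> w; rewrite addrC; apply: (sq (f w - u w) (g w - v w)); exact: Hop2.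
by lra.
Qed.

Lemma approximableD f g : approximable f -> approximable g -> approximable (f + g).
Proof.
move=> Hf Hg; apply: (approximable_op2 (op := fun a b => a + b)) => //.
- by move=> *; exact: measurable_funD.
- by move=> a b; exact: ler_normD.
- by move=> a b a' b'; rewrite opprD addrACA; exact: ler_normD.
Qed.

Lemma approximableB f g : approximable f -> approximable g -> approximable (f - g).
Proof.
move=> Hf Hg; apply: (approximable_op2 (op := fun a b => a - b)) => //.
- by move=> *; exact: measurable_funB.
- by move=> a b; exact: ler_normB.
- move=> a b a' b'; rewrite (_ : _ - _ - _ = (a - a') - (b - b')); last by ring.
  exact: ler_normB.
Qed.

Lemma approximable_max f g : approximable f -> approximable g ->
  approximable (fun w => Num.max (f w) (g w)).
Proof.
move=> Hf Hg; apply: (approximable_op2 (op := Num.max)) => //.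
- by move=> *; exact: measurable_maxr.
- move=> a b; have := normr_ge0 a; have := normr_ge0 b.
  by rewrite /Num.max; case: ifP => _; lra.
- move=> a b a' b'; have := ler_norm (a - a'); have := ler_norm (b - b').
  have := ler_norm (- (a - a')); have := ler_norm (- (b - b')); rewrite !normrN.
  by rewrite ler_norml; case: (lerP a b) => ?; case: (lerP a' b') => ?;
    move=> *; apply/andP; split; lra.
Qed.

Lemma approximableZ c f : approximable f -> approximable (c *: f).
Proof.
move=> [Lf Hf]; split=> [|e e0]; first exact: sqr_integrableZ.
have c1 : 0 < c ^+ 2 + 1 by rewrite ltr_wpDl ?sqr_ge0.
have [g cg Hg] := Hf _ (divr_gt0 e0 c1); have Lg := cylinder_L2 cg.
exists (c *: g).
  case: cg => mg [S [K [dg gK]]]; split; first by apply: measurable_funM.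
  have E w : (c *: g) w = c * g w by [].
  exists S, (`|c| * K); split=> [w w' Ew|w]; first by rewrite !E (dg w w').
  by rewrite E normrM; apply: ler_wpM2l.
have Lfg : L2 (f - g) by exact: sqr_integrableB.
rewrite -scalerBr l2dotZl //; last exact: sqr_integrableZ.
rewrite l2dotC l2dotZl // mulrA -expr2.
apply: (@le_lt_trans _ _ ((c ^+ 2 + 1) * l2dot P (f - g) (f - g))).
  by apply: ler_wpM2r; rewrite ?l2dot_ge0 // lerDl.
by rewrite -ltr_pdivlMl // mulrC.
Qed.

(** Domination of the squared errors by [g ^+ 2] gives convergence in mean square, and an
    approximant of a late [F n] then serves for [f]. *)
Lemma approximable_lim f g (F : nat -> Omega d -> R) : L2 f -> L2 g ->
  (forall n, approximable (F n)) ->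
  (forall w n, (f w - F n w) ^+ 2 <= g w ^+ 2) ->
  (forall w, F n w @[n --> \oo] --> f w) -> approximable f.
Proof.
move=> Lf Lg HF Fg Ff; split=> // e e0.
have LF n : L2 (F n) by have [] := HF n.
have LfF n : L2 (f - F n) by exact: sqr_integrableB.
have cvg : (\int[P]_w ((f w - F n w) ^+ 2)%:E @[n --> \oo] --> \int[P]_w (0 : \bar R))%E.
  have H1 n : measurable_fun [set: Omega d] (fun w => ((f w - F n w) ^+ 2)%:E).
    apply/measurable_EFinP; apply: measurable_funX.
    by apply: measurable_funB; [exact: Lf.1 | exact: (LF n).1].
  have H3 w : ((f w - F n w) ^+ 2)%:E @[n --> \oo] --> 0%E.
    have h : (fun n => f w - F n w) @ \oo --> f w - f w.
      by apply: cvgB; [exact: cvg_cst | exact: Ff].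
    have := cvgM h h; rewrite subrr mulr0 => h2.
    by apply/fine_cvgP; split; [exact: nearW | exact: h2].
  have H2 : measurable_fun [set: Omega d] (cst 0%E : Omega d -> \bar R) by [].
  have [] := @dominated_convergence _ _ _ P setT measurableT
    (fun n w => ((f w - F n w) ^+ 2)%:E) (cst 0%E) (fun w => (g w ^+ 2)%:E) H1
    H2 _ (sqr_integrable_sqr Lg) _ => //.
  - by apply/aeW => w _; exact: H3.
  - by apply/aeW => w n _; rewrite gee0_abs ?lee_fin ?sqr_ge0.
rewrite integral0 in cvg.
have e8 : 0 < e / 8 by rewrite divr_gt0.
have [n Hn] : exists n, l2dot P (f - F n) (f - F n) < e / 4.
  move: cvg => /fine_cvgP[_ /cvgrPdist_lt /(_ _ e8) [n _ H]].
  exists n; have := H n (leqnn n); rewrite /= sub0r normrN => h.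
  have h2 : l2dot P (f - F n) (f - F n) = fine (\int[P]_w ((f w - F n w) ^+ 2)%:E)%E.
    by rewrite -(l2dotE (LfF n)).
  by rewrite h2; have := le_lt_trans (ler_norm _) h; lra.
have [_ /(_ _ e8)[h ch Hh]] := HF n.
exists h => //; have Lh := cylinder_L2 ch.
have L1 : L2 (f - h) by exact: sqr_integrableB.
have := sqr_le L1 (LfF n).
have -> : f - h - (f - F n) = F n - h by rewrite opprB addrC addrA subrK.
by lra.
Unshelve. all: by end_near. Qed.

Let approximable_cst c : approximable (fun=> c).
Proof.
apply: approximable_cylinder; split => //.
by exists [::], `|c|; split.
Qed.

Lemma indic_bounded A w : `|\1_A w : R| <= 1.
Proof. by rewrite indicE; case: (w \in A); rewrite ?normr1 ?normr0. Qed.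

(** The events with approximable indicator form a sigma-algebra containing the coordinate events:
    complements by differences, countable unions as limits of finite unions, which are maxima.
    Measurability is carried along because the limit step needs it. *)
Lemma approximable_indic A : measurable A -> approximable (\1_A).
Proof.
move=> mA; suff [] : measurable A /\ approximable (\1_A) by [].
have bigcup_case (F : nat -> set (Omega d)) :
    (forall n, measurable (F n) /\ approximable (\1_(F n))) ->
    measurable (\bigcup_n F n) /\ approximable (\1_(\bigcup_n F n)).
  move=> HF.
  have mU : measurable (\bigcup_k F k) by apply: bigcupT_measurable => k; have [] := HF k.
  split => //.
  pose B n := \big[setU/set0]_(i < n) F i.
  have HB n : approximable (\1_(B n)).
    rewrite /B; elim: n => [|n IH]; first by rewrite big_ord0 indic0; exact: approximable_cst.
    rewrite big_ord_recr /=.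
    have [_ Hn] := HF n; have := approximable_max IH Hn; congr approximable.
    apply/funext => w; rewrite !indicE in_setU.
    by case: (w \in _); case: (w \in _); rewrite /Num.max ?ltxx ?ltr01 ?ltr10.
  have L1 : L2 (\1_(\bigcup_k F k)).
    apply: (sqr_integrable_bounded _ (indic_bounded _)); exact: measurable_indic.
  apply: (approximable_lim L1 (sqr_integrable_cst P 1) HB).
    move=> w n; rewrite expr1n !indicE.
    by case: (w \in _); case: (w \in _);
      rewrite ?subrr ?subr0 ?sub0r ?sqrrN ?expr1n ?expr0n.
  move=> w; apply: cvg_near_cst; have [Uw|Uw] := pselect ((\bigcup_k F k) w).
    have [k _ Fk] := Uw; exists k.+1 => // n /= kn.
    rewrite !indicE !mem_set //; rewrite /B -bigcup_mkord; exists k => //.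
  apply: nearW => n; rewrite !indicE !memNset // => Bn; apply: Uw.
  by move: Bn; rewrite /B -bigcup_mkord => -[k _ Fk]; exists k.
move: A mA; apply: smallest_sub.
  split => /=.
  - split; first exact: measurable0.
    by rewrite indic0; exact: approximable_cst.
  - move=> A [mA HA]; rewrite setTD; split; first exact: measurableC.
    rewrite (_ : \1_(~` A) = (fun=> 1) - \1_A); first exact: approximableB.
    apply/funext => w; have -> : ((fun=> 1) - \1_A : Omega d -> R) w = 1 - \1_A w by [].
    rewrite !indicE in_setC.
    by case: (w \in A); rewrite /= ?mulr1n ?mulr0n ?subrr ?subr0.
  - exact: bigcup_case.
move=> _ [x [b ->]]; have mC := measurable_coord x b; split => //.
apply: approximable_cylinder; split; first exact: measurable_indic.
exists [:: x], 1; split; last exact: indic_bounded.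
move=> w w' E; rewrite !indicE; congr (_%:R); congr nat_of_bool.
have Ex : w x = w' x by apply: E; rewrite mem_head.
apply/idP/idP => /set_mem H; apply/mem_set; move: H; rewrite /mkset.
  by rewrite -Ex.
by rewrite Ex.
Qed.

Import HBNNSimple.

Lemma approximable_nnsfun (h : {nnsfun Omega d >-> R}) : approximable h.
Proof.
rewrite (_ : (h : Omega d -> R) = \sum_(i < #|` fset_set (h @` setT)|)
   ((fset_set (h @` setT))`_i *: \1_(h @^-1` [set (fset_set (h @` setT))`_i]))).
  apply: big_ind => [|f g|i _]; first exact: approximable_cst.
    exact: approximableD.
  by apply: approximableZ; apply: approximable_indic.
by apply/funext => w; rewrite fct_sumE (fimfunEord h).
Qed.

Lemma approximable_ge0 f : L2 f -> (forall w, 0 <= f w) -> approximable f.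
Proof.
move=> Lf f0.
have mf : measurable_fun [set: Omega d] (EFin \o f) by apply/measurable_EFinP; exact: Lf.1.
have f0' : forall w, [set: Omega d] w -> (0 <= (EFin \o f) w)%E.
  by move=> w _; rewrite lee_fin.
pose F n : Omega d -> R := nnsfun_approx measurableT mf n.
(* The simple functions increase to [f] and stay between 0 and [f], so [f] itself dominates the
   errors. *)
apply: (approximable_lim (f := f) (g := f) (F := F)) => //.
- by move=> n; exact: approximable_nnsfun.
- move=> w n.
  have Fle : F n w <= f w.
    rewrite /F nnsfun_approxE -lee_fin; exact: (le_approx n f0').
  have F0 : 0 <= F n w by rewrite /F.
  by rewrite ler_sqr ?nnegrE ?subr_ge0 // gerBl.
- move=> w; have := cvg_nnsfun_approx measurableT mf f0' (x := w) I.
  by move/fine_cvgP => [].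
Qed.

Lemma sqr_integrable_approximable f : L2 f -> approximable f.
Proof.
move=> Lf; have mf := Lf.1.
have Lmax u : L2 u -> L2 (fun w => Num.max (u w) 0).
  move=> Lu; apply: (sqr_integrable_le _ Lu).
    by apply: measurable_maxr => //; exact: Lu.1.
  move=> w; rewrite /Num.max; case: ifP => // _.
  by rewrite expr0n sqr_ge0.
rewrite (_ : f = (fun w => Num.max (f w) 0) - (fun w => Num.max (- f w) 0)).
  have LN : L2 (fun w => - f w) by have := sqr_integrableZ (-1) Lf; rewrite scaleN1r.
  apply: approximableB; apply: approximable_ge0.
  - exact: Lmax.
  - by move=> w; rewrite le_max lexx orbT.
  - exact: (Lmax _ LN).
  - by move=> w; rewrite le_max lexx orbT.
apply/funext => w.
have -> : ((fun w => Num.max (f w) 0) - (fun w => Num.max (- f w) 0)) w =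
  Num.max (f w) 0 - Num.max (- f w) 0 by [].
by case: (lerP (f w) 0) => h; case: (lerP (- f w) 0) => h'; lra.
Qed.

End CylinderDensity.

(** * The Poincare inequality *)

Section RelaxLinear.
Context (R : realFieldType) (V : lmodType R) (I : eqType).
Variables (D : I -> {linear V -> V}) (s : seq I).

Lemma relaxB (f g : V) : relax D s (f - g) = relax D s f - relax D s g.
Proof.
rewrite /relax /generator.
under eq_bigr do rewrite linearB.
by rewrite sumrB scalerBr !opprD opprK addrACA.
Qed.

Lemma iter_relaxB k (f g : V) :
  iter k (relax D s) (f - g) = iter k (relax D s) f - iter k (relax D s) g.
Proof. by elim: k => [|k IH] //=; rewrite IH relaxB. Qed.
End RelaxLinear.

Section Poincare.
Context (d : nat) (R : realType) (P : probability (Omega d) R).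
Variables (r : site d -> Omega d -> R) (lam : R).
Hypothesis r_gt0 : forall x w, 0 < r x w.
Hypothesis mr : forall x, measurable_fun [set: Omega d] (r x).
Hypothesis r_flip : forall x w, r x (flip x w) * r x w = 1.
Hypothesis r_comm : forall x y w, x != y ->
  r x w * r y (flip x w) = r y w * r x (flip y w).
Hypothesis r_nonadj : forall x y w, x != y -> x \notin nbrs y -> r y (flip x w) = r y w.
Hypothesis r_le : forall x y w, x != y -> r y (flip x w) <= lam * r y w.
Hypothesis r_local : forall x w w', {in x :: nbrs x, w =1 w'} -> r x w = r x w'.
Hypothesis lam_ge1 : 1 <= lam.
Hypothesis lam_small : d%:R * (lam - 1) < 1.
Hypothesis r_inv : forall x (F : Omega d -> \bar R),
  measurable_fun [set: Omega d] F -> (forall w, 0 <= F w)%E ->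
  (\int[P]_w (F (flip x w) * (r x w)%:E) = \int[P]_w F w)%E.
Implicit Types (f g : Omega d -> R) (s : seq (site d)).
Local Notation L2 := (sqr_integrable P).
Local Notation ip := (l2dot P).
Let gam : R := 1 - d%:R * (lam - 1).
Let gam_gt0 : 0 < gam. Proof. by rewrite subr_gt0. Qed.

Let L2D := @sqr_integrableD _ _ _ P.
Let L2Z := @sqr_integrableZ _ _ _ P.
Let L20 := @sqr_integrable0 _ _ _ P.
Let L2x := sqr_integrable_fluct r_gt0 mr r_inv.
Let ipC := @l2dotC _ _ _ P.
Let ipD := @l2dotDl _ _ _ P.
Let ipZ := @l2dotZl _ _ _ P.
Let ip0 := @l2dot_ge0 _ _ _ P.
Let ipP := l2dot_fluct_proj r_gt0 mr r_flip r_inv.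

Lemma fluct_curvature s f : uniq s -> L2 f ->
  gam * energy ip (fluct r) s f <= ip (generator (fluct r) s f) (generator (fluct r) s f).
Proof.
move=> us Lf; have Lx x := L2x x Lf.
have -> : ip (generator (fluct r) s f) (generator (fluct r) s f) =
    \sum_(x <- s) \sum_(y <- s) ip (fluct r x f) (fluct r y f).
  rewrite (form_suml L2D L20 ipD ipZ) //; last exact: (H_generator L2D L20 L2x).
  by apply: eq_bigr => x _; rewrite (form_sumr L2D L20 ipC ipD ipZ s Lx (Lx x)).
(* [curvature_sum] is applied with the pair constant [(lam - 1) / 4] and the degree [2 d]. *)
have -> : gam = 1 - 2 * ((lam - 1) / 4) * (2 * d)%:R.
  by rewrite /gam natrM; field.
apply: (curvature_sum (nb := fun x y => y \in nbrs x)
  (M := fun x y => ip (fluct r x f) (fluct r y f)) us) => [||x|x|x y xy].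
- by rewrite divr_ge0 // subr_ge0.
- by move=> x y; rewrite nbrs_sym.
- rewrite -size_filter -(size_nbrs x); apply: uniq_leq_size.
    exact: filter_uniq.
  by move=> y; rewrite mem_filter => /andP[].
- exact: l2dot_ge0.
- exact: (l2dot_fluct_pair r_gt0 mr r_flip r_comm r_nonadj r_le lam_ge1 r_inv xy Lf).
Qed.

Lemma fluct_cst x (c : R) : fluct r x (cst c) = 0.
Proof. by apply/funext => w; rewrite /fluct subrr mulr0. Qed.

(** Constants have no fluctuation, so by the projection property every [fluct x f] is orthogonal to
    them. *)
Lemma relax_mean s k g : L2 g -> L2 (iter k (relax (fluct r) s) g) /\
  ip (iter k (relax (fluct r) s) g) (cst 1) = ip g (cst 1).
Proof.
move=> Lg; elim: k => [|k [Lk IH]] //=; split; first exact: (H_relax L2D L2Z L20 L2x).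
rewrite -IH; set u := iter k _ g in Lk *.
have L1 := sqr_integrable_cst P 1.
have Lgen := H_generator L2D L20 L2x s Lk.
rewrite /relax (form_subl L2Z ipD ipZ) //; last exact: L2Z.
rewrite ipZ // (form_suml L2D L20 ipD ipZ) //; last by move=> x; exact: L2x.
rewrite big1 ?mulr0 ?subr0 // => x _; rewrite ipP // fluct_cst.
by rewrite ipC -(scale0r (cst 1 : Omega d -> R)) ipZ ?mul0r //; exact: L2x.
Qed.

Lemma ip_cst (c : R) : ip (cst c) (cst c) = c ^+ 2.
Proof.
rewrite /l2dot -[X in Rintegral _ _ X]/(fun=> c * c).
by rewrite Rintegral_cst //= probability_setT mulr1 expr2.
Qed.

(** A function of oscillation at most [e] stays within [e] of its mean. The mean is kept in the
    bound because the cylinder approximant of a centred function need not be centred. *)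
Lemma variance_osc_le g e : L2 g -> 0 <= e -> (forall w w', `|g w - g w'| <= e) ->
  ip g g <= 2 * ip g (cst 1) ^+ 2 + 2 * e ^+ 2.
Proof.
move=> Lg e0 Hg; set c := ip g (cst 1).
have ig := sqr_integrable_integrable Lg.
have cE : c = (\int[P]_w g w)%R by apply: eq_Rintegral => w _; rewrite mulr1.
have ic (a : R) : P.-integrable setT (EFin \o (fun=> a) : Omega d -> \bar R).
  exact: (sqr_integrable_integrable (sqr_integrable_cst P a)).
have intc (a : R) : (\int[P]_(w in setT) a)%R = a.
  by rewrite Rintegral_cst //= probability_setT mulr1.
have dev w : `|g w - c| <= e.
  rewrite ler_norml; apply/andP; split.
    rewrite lerBrDl addrC -lerBrDl opprK cE -[leRHS](intc (g w + e)).
    apply: le_Rintegral => // w' _; have := Hg w w'; rewrite ler_norml => /andP[h1 h2]; lra.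
  rewrite lerBlDl -lerBlDr cE -[leLHS](intc (g w - e)).
  apply: le_Rintegral => // w' _; have := Hg w w'; rewrite ler_norml => /andP[h1 h2]; lra.
have Lc := sqr_integrable_cst P c.
have := form_sqr_le L2D L2Z ipC ipD ipZ ip0 Lg Lc; rewrite ip_cst => h.
apply: le_trans h _; rewrite lerD2l ler_pM2l // -ip_cst; apply: l2dot_le.
- exact: sqr_integrableB.
- exact: sqr_integrable_cst.
- move=> w; have -> : (g - cst c) w = g w - c by [].
  by rewrite -(real_normK (num_real (g w - c))) ler_sqr ?nnegrE.
Qed.

(** The bound [E] is required for every finite [s] because [s] and [k] come from the mixing of an
    approximant that depends on [eps]. That approximant is used only for the norm of [T^k f]; the
    energy remains that of [f]. *)
Lemma centered_poincare f E : L2 f -> ip f (cst 1) = 0 ->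
  (forall s, uniq s -> energy ip (fluct r) s f <= E) -> ip f f <= 2 / gam * E.
Proof.
move=> Lf f0 HE; apply/ler_addgt0Pr => eps eps0.
(* With [|f - g|^2 < eta], the mean of [g] squared is at most [eta], so [|T^k g|^2 <= 4 eta] and
   [|T^k f|^2 <= 2 * 4 eta + 2 eta]. *)
have eta0 : 0 < eps / 10 by rewrite divr_gt0.
have [_ /(_ _ eta0) [g cg Hg]] := sqr_integrable_approximable Lf.
have Lg := cylinder_L2 P cg; have [_ [S [K [dS gK]]]] := cg.
set eta := eps / 10 in eta0 Hg.
pose e := Num.sqrt eta.
have e0 : 0 < e by rewrite sqrtr_gt0.
have eE : e ^+ 2 = eta by rewrite sqr_sqrtr // ltW.
have [s [k [us s0 Hmix]]] := relax_mixing r_gt0 r_flip r_nonadj r_le r_local lam_ge1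
  lam_small dS gK e0.
have V1 := iter_relax_variance L2D L2Z L20 L2x ipC ipD ipZ ip0 ipP s0 gam_gt0
  (fun f => fluct_curvature us) k Lf.
have [Lh hm] := relax_mean s k Lg.
have Lfg : L2 (f - g) by exact: sqr_integrableB.
have [Lkf _] := relax_mean s k Lf.
have V2 := form_sqr_le L2D L2Z ipC ipD ipZ ip0 Lkf Lh.
have V3 := iter_relax_contract L2D L2Z L20 L2x ipC ipD ipZ ip0 ipP s0 k Lfg.
rewrite iter_relaxB in V3.
have V4 := variance_osc_le Lh (ltW e0) Hmix; rewrite hm eE in V4.
have V5 : ip g (cst 1) ^+ 2 <= ip (f - g) (f - g).
  have L1 := sqr_integrable_cst P 1.
  have -> : ip g (cst 1) = - ip (f - g) (cst 1).
    by rewrite (form_subl L2Z ipD ipZ) // f0 sub0r opprK.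
  rewrite sqrrN; have := Rintegral_mean_sqr Lfg.
  rewrite (_ : (\int[P]_w (f - g) w)%R = ip (f - g) (cst 1)) //.
  by apply: eq_Rintegral => w _; rewrite mulr1.
have V6 : 2 / gam * energy ip (fluct r) s f <= 2 / gam * E.
  by apply: ler_wpM2l; [rewrite divr_ge0 // ltW | exact: HE].
have E10 : eps = 10 * eta by rewrite /eta; field.
by lra.
Qed.

Lemma abstract_poincare f : L2 f ->
  (\int[P]_w ((f w - fine (\int[P]_v (f v)%:E)) ^+ 2)%:E <=
    (2 / gam)%:E * dirichlet_form P f)%E.
Proof.
move=> Lf; set m := fine _.
have Lf0 : L2 (f - cst m) by apply: sqr_integrableB => //; exact: sqr_integrable_cst.
have -> : (\int[P]_w ((f w - m) ^+ 2)%:E = (ip (f - cst m) (f - cst m))%:E)%E.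
  exact: (esym (l2dotE Lf0)).
have D0 : (0 <= dirichlet_form P f)%E.
  apply: esum_ge0 => x _; apply: integral_ge0 => w _; by rewrite lee_fin sqr_ge0.
have g2 : 0 < 2 / gam by rewrite divr_gt0.
have Hs s : uniq s -> ((energy ip (fluct r) s (f - cst m))%:E <= dirichlet_form P f)%E.
  move=> us; rewrite /energy -sumEFin.
  apply: (@le_trans _ _ (\sum_(x <- s) \int[P]_w ((f (flip x w) - f w) ^+ 2)%:E)%E).
    apply: lee_sum => x _; apply: le_trans (l2dot_fluct_le r_gt0 mr r_inv x Lf0) _.
    rewrite le_eqVlt; apply/orP; left; apply/eqP; apply: eq_integral => w _.
    congr (_ ^+ 2)%:E; have E w' : (f - cst m) w' = f w' - m by [].
    by rewrite !E; ring.
  apply: ereal_sup_ubound => /=; exists [set` s]; last by rewrite -fsbig_seq.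
  by split; [exact: finite_seq | exact: subsetT].
(* For an infinite form the right-hand side is infinite; otherwise its value is the uniform bound on
   the finite energies. *)
case Ed : (dirichlet_form P f) D0 => [D||] D0 //; last first.
  by rewrite gt0_muley ?lte_fin // leey.
rewrite -EFinM lee_fin; apply: centered_poincare => //.
  rewrite (form_subl L2Z ipD ipZ) //; last 2 first.
  - exact: sqr_integrable_cst.
  - exact: sqr_integrable_cst.
  have -> : ip f (cst 1) = m by apply: eq_Rintegral => w _; rewrite mulr1.
  have -> : ip (cst m) (cst 1) = m.
    rewrite /l2dot -[X in Rintegral _ _ X]/(fun=> m * 1).
    by rewrite Rintegral_cst //= probability_setT !mulr1.
  by rewrite subrr.
by move=> s us; have := Hs s us; rewrite Ed lee_fin.
Qed.

End Poincare.

Lemma flip_ratio_local (d : nat) (R : realType) (beta J : R) (x : site d) (w w' : Omega d) :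
  {in x :: nbrs x, w =1 w'} -> flip_ratio beta J x w = flip_ratio beta J x w'.
Proof.
move=> E; have Es y : y \in x :: nbrs x -> spin R w y = spin R w' y.
  by move=> yx; rewrite /spin E.
rewrite /flip_ratio !nbr_sumE Es ?mem_head //; congr (expR (- (_ * (_ * _)))).
by apply: eq_big_seq => y yx; apply: Es; rewrite in_cons yx orbT.
Qed.

Lemma bernoulli_le (R : realFieldType) (a : R) n : 1 <= a -> 1 + n%:R * (a - 1) <= a ^+ n.
Proof.
move=> a1; elim: n => [|n IH]; first by rewrite mul0r addr0 expr0.
rewrite exprS; apply: le_trans (ler_wpM2l (le_trans ler01 a1) IH).
have -> : n.+1%:R = n%:R + 1 :> R by rewrite natr1.
have : 0 <= n%:R * (a - 1) ^+ 2 by rewrite mulr_ge0 ?sqr_ge0.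
have -> : a * (1 + n%:R * (a - 1)) = 1 + (n%:R + 1) * (a - 1) + n%:R * (a - 1) ^+ 2.
  by ring.
by rewrite lerDl.
Qed.

Theorem theorem1 (d : nat) (R : realType) (beta J h : R)
  (P : probability (Omega d) R) :
  (2 <= d)%N -> 0 < beta -> (J = 1 \/ J = -1) -> h = 0 ->
  ising_mrf beta J h P ->
  expR (- (2 * beta * h)) * (expR (4 * beta * d%:R) - expR (- (4 * beta * d%:R))) < 1 ->
  (forall Q : probability (Omega d) R,
     bernoulli_site (expR (- (2 * beta * h)) *
                     (expR (4 * beta * d%:R) - expR (- (4 * beta * d%:R)))) Q ->
     (\int[Q]_w size_weight (2 * beta * h + 4 * beta * d%:R) (cluster_size R w)
        < +oo)%E) ->
  exists CP : R, 0 < CP /\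
    forall f : Omega d -> R,
      measurable_fun setT f ->
      (\int[P]_w ((f w) ^+ 2)%:E < +oo)%E ->
      (\int[P]_w ((f w - fine (\int[P]_v (f v)%:E)) ^+ 2)%:E
         <= CP%:E * dirichlet_form P f)%E.
Proof.
move=> d2 b0 HJ h0 mrf hp _; rewrite h0 in mrf hp.
pose lam := expR (4 * beta).
have b4 : 0 < 4 * beta by rewrite mulr_gt0.
have lam_ge1 : 1 <= lam by rewrite -[leLHS](@expR0 R) ler_expR ltW.
have lam_small : d%:R * (lam - 1) < 1.
  rewrite mulr0 oppr0 expR0 mul1r in hp.
  have uE : expR (4 * beta * d%:R) = lam ^+ d by rewrite -expRM_natr.
  (* Bounding the subtracted exponential by 1 turns [p < 1] into [lam ^+ d < 2]. *)
  have u1 : expR (- (4 * beta * d%:R)) <= 1.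
    by rewrite -[leRHS](@expR0 R) ler_expR oppr_le0 mulr_ge0 // ltW.
  by have := bernoulli_le d lam_ge1; rewrite -uE; lra.
exists (2 / (1 - d%:R * (lam - 1))); split.
  by rewrite divr_gt0 // subr_gt0.
move=> f mf f2; apply: (@abstract_poincare d R P (flip_ratio beta J) lam).
- by move=> x w; exact: flip_ratio_gt0.
- exact: measurable_flip_ratio.
- exact: flip_ratio_flip.
- exact: flip_ratio_comm.
- exact: flip_ratio_nonadj.
- by move=> x y w; exact: flip_ratio_le.
- exact: flip_ratio_local.
- exact: lam_ge1.
- exact: lam_small.
- exact: flip_quasi_invariant.
- by split.
Qed.
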